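(* In the cost setting described in the context, the (expected pseudo-)regret incurred by the subroutine CSE run with elimination threshold $B>0$ (i.e. $\mathbb{E}[\sum_t\Delta_{i_t}]$ summed over the steps played by CSE until it returns) is at most $$\sum_{i:\Delta_i>0}\frac{129\log T}{\Delta_i}+8D\min\{B,\;D\Delta_{\max}\}\log K .$$
   Context: Delay-as-payoff bandit: there are $K$ arms, a horizon $T$ and a maximum delay $D\in\mathbb{N}$. Each arm $i\in[K]$ has an unknown distribution $\mathcal{D}_i$ supported on $\{0,1,\dots,D\}$. At each step $t$ the agent chooses an arm $i_t$ based on the feedback observed so far, and a delay $d_t\sim\mathcal{D}_{i_t}$ is drawn independently; $d_t$ is revealed only at time $t+d_t$. The payoff of step $t$ is the cost $c_t=d_t/D$, to be minimized. Let $\mu(i)=\mathbb{E}_{X\sim\mathcal{D}_i}[X/D]$, $\mu^*=\min_i\mu(i)$ attained at a unique arm $i^*$, $\Delta_i=\mu(i)-\mu^*$, $\Delta_{\max}=\max_i\Delta_i$. Notation at time $t$: $n_t(i)$ is the number of steps $s\le t$ with $i_s=i$; $M_t(i)=\{s\le t: i_s=i,\ s+d_s\ge t\}$, $m_t(i)=|M_t(i)|$; $\mathcal{O}_t(i)=\{s\le t: i_s=i,\ s+d_s<t\}$; $F_t(i)=\{s\le t-D: i_s=i\}$; $a\vee b=\max\{a,b\}$. CSE (Cost Successive Elimination) with inputs $T$, $K$, $D$, threshold $B$: start with $t=1$ and active set $S=[K]$. While $t<T$: play each arm of $S$ once (round robin), observe arriving feedback, set $t\leftarrow t+|S|$; for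 each $i\in S$ compute $\hat\mu^-_t(i)=\frac{1}{n_t(i)}\big(\sum_{s\in M_t(i)}\frac{t-s}{D}+\sum_{s\in\mathcal{O}_t(i)}c_s\big)$, $L^1_t(i)=\hat\mu^-_t(i)-\sqrt{2\log T/n_t(i)}$; $\hat\mu^F_t(i)=\frac{1}{|F_t(i)|\vee1}\sum_{s\in F_t(i)}c_s$, $L^2_t(i)=\hat\mu^F_t(i)-\sqrt{2\log T/(|F_t(i)|\vee1)}$; $L^3_t(i)=\frac{|S|}{D}\big(\frac{m_t(i)}{2}-8\log T-1\big)$; $LCB_t(i)=\max\{L^1_t(i),L^2_t(i),L^3_t(i)\}$, $UCB_t(i)=\hat\mu^F_t(i)+\sqrt{2\log T/(|F_t(i)|\vee1)}$. Then remove from $S$ every arm $i$ for which some $j\in S$ has $\min\{UCB_t(j),B\}<LCB_t(i)$; if $S=\emptyset$ return (Fail, $t$). If the loop ends return (Success, $t$). *)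

(* Defs.v *)
From HB Require Import structures.
From mathcomp Require Import all_boot all_order all_algebra.
From mathcomp Require Import reals exp.
Set Implicit Arguments. Unset Strict Implicit. Unset Printing Implicit Defensive.
Import Order.TTheory GRing.Theory Num.Theory.
Local Open Scope ring_scope.

Section CSE.
Variables (R : realType) (K D T : nat) (B : R).

(* Played steps, as pairs (step index s >= 1, arm i_s); arms.[s-1] = i_s. *)
Definition steps (arms : seq 'I_K) : seq (nat * 'I_K) :=
  zip (iota 1 (size arms)) arms.

Definition cost (d : nat -> nat) (s : nat) : R := (d s)%:R / D%:R.

Definition logT : R := ln T%:R.

Definition n_t (arms : seq 'I_K) (t : nat) (i : 'I_K) : nat :=
  size [seq q <- steps arms | (q.1 <= t)%N && (q.2 == i)].

Definition M_t (d : nat -> nat) arms t i : seq nat :=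
  map fst [seq q <- steps arms | [&& (q.1 <= t)%N, q.2 == i & (t <= q.1 + d q.1)%N]].

Definition O_t (d : nat -> nat) arms t i : seq nat :=
  map fst [seq q <- steps arms | [&& (q.1 <= t)%N, q.2 == i & (q.1 + d q.1 < t)%N]].

(* F_t(i) = {s <= t - D : i_s = i}  (s + D <= t, the integer reading of t - D) *)
Definition F_t arms t i : seq nat :=
  map fst [seq q <- steps arms | ((q.1 + D <= t)%N) && (q.2 == i)].

Definition mu_minus d arms t i : R :=
  (\sum_(s <- M_t d arms t i) (t - s)%:R / D%:R
   + \sum_(s <- O_t d arms t i) cost d s) / (n_t arms t i)%:R.

Definition L1 d arms t i : R :=
  mu_minus d arms t i - Num.sqrt (2 * logT / (n_t arms t i)%:R).

Definition nF arms t i : nat := maxn (size (F_t arms t i)) 1.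

Definition mu_F d arms t i : R :=
  (\sum_(s <- F_t arms t i) cost d s) / (nF arms t i)%:R.

Definition L2 d arms t i : R :=
  mu_F d arms t i - Num.sqrt (2 * logT / (nF arms t i)%:R).

Definition L3 d arms t (S : {set 'I_K}) i : R :=
  (#|S|%:R / D%:R) * ((size (M_t d arms t i))%:R / 2 - 8 * logT - 1).

Definition LCB d arms t S i : R :=
  Num.max (L1 d arms t i) (Num.max (L2 d arms t i) (L3 d arms t S i)).

Definition UCB d arms t i : R :=
  mu_F d arms t i + Num.sqrt (2 * logT / (nF arms t i)%:R).

Definition eliminate d arms t (S : {set 'I_K}) : {set 'I_K} :=
  [set i in S | ~~ [exists j in S, Num.min (UCB d arms t j) B < LCB d arms t S i]].

(* One run of CSE given the delay of each step (d s = delay of step s).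
   State: current time t, active set S, list of arms played so far.
   Returns (success?, final t, played arms). The fuel is never exhausted
   (each round increases t by at least 1, starting from t = 1). *)
Fixpoint cse_loop (fuel : nat) (d : nat -> nat) (t : nat) (S : {set 'I_K})
    (arms : seq 'I_K) : bool * nat * seq 'I_K :=
  match fuel with
  | 0 => (true, t, arms)
  | fuel'.+1 =>
    if (t < T)%N then
      let arms' := arms ++ enum S in
      let t' := (t + #|S|)%N in
      let S' := eliminate d arms' t' S in
      if S' == set0 then (false, t', arms')
      else cse_loop fuel' d t' S' arms'
    else (true, t, arms)
  end.

Definition cse_arms (d : nat -> nat) : seq 'I_K :=
  (cse_loop T.+1 d 1 [set: 'I_K] [::]).2.

(* Probability model: delays of steps 0..T+K (step 0 unused; CSE plays at
   most T+K-2 steps). A delay path ds has probability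
   prod over played steps s of P[D_{i_s} = ds s], and unplayed coordinates
   are fixed to 0 (point mass), so that the weights sum to 1. *)
Definition H : nat := (T + K)%N.

Definition dfun (ds : {ffun 'I_H.+1 -> 'I_D.+1}) : nat -> nat :=
  fun s => nat_of_ord (ds (inord s)).

Definition path_weight (p : 'I_K -> 'I_D.+1 -> R) (ds : {ffun 'I_H.+1 -> 'I_D.+1}) : R :=
  let arms := cse_arms (dfun ds) in
  (\prod_(q <- steps arms) p q.2 (ds (inord q.1)))
  * \prod_(s < H.+1 | ~~ ((1 <= s)%N && (s <= size arms)%N)) (ds s == ord0)%:R.

Definition mu (p : 'I_K -> 'I_D.+1 -> R) (i : 'I_K) : R :=
  \sum_(x < D.+1) p i x * (x%:R / D%:R).

Definition gap p (istar i : 'I_K) : R := mu p i - mu p istar.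

Definition gapmax p istar : R := \big[Num.max/0]_(i < K) gap p istar i.

Definition cse_regret p istar : R :=
  \sum_(ds : {ffun 'I_H.+1 -> 'I_D.+1})
     path_weight p ds * \sum_(a <- cse_arms (dfun ds)) gap p istar a.

End CSE.

(* Main.v *)
(* Let L = ln T. On a good event of probability at least 1 - 4 / T^2, every
   empirical mean of the first n plays of an arm is within sqrt(2 L / n) of the
   mean, and at every time t the number m of pending plays of an arm is at most
   16 L plus twice the sum, over its plays, of the probability of being pending.
   Any w consecutive steps contain at most w / |S| + 1 plays of an active arm, so
   that this sum is at most D mu(i) / |S| + 1; hence all three lower bounds are
   valid, and the best arm is eliminated only if B < mu*.

   Let g be the gap of an arm that has survived an elimination with active set
   S after n plays. Survival gives LCB <= B, and also LCB <= UCB of the best arm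
   as long as the latter is active.
   If g <= 3 B, then L2 shows that only O(L / g^2) of the plays are older
   than D steps, and the last D steps contain at most D / |S| + 1 plays.
   If g > 3 B, then L3 <= B bounds the number m of pending plays, and L1 <= B
   reads g - B <= 2 sqrt(2 L / n) + m / n.
   In both cases n g <= 110 L / g + (16 / 5) D min(B, D gap_max) / |S|, and summing
   1 / |S| over the successively eliminated arms gives a harmonic sum.

   On the bad event the regret is at most T times the sum of the gaps when
   K < T; when T <= K a single round is played. *)
Require Import Defs.
From HB Require Import structures.
From mathcomp Require Import all_boot all_order all_algebra.
From mathcomp Require Import ring lra zify.
From mathcomp Require boolp functions topology normedtype derive realfun.
From mathcomp Require Import reals sequences exp.
Import Order.TTheory GRing.Theory Num.Theory.
Set Implicit Arguments. Unset Strict Implicit. Unset Printing Implicit Defensive.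
Local Open Scope ring_scope.

(** * Exponential moments *)

Section BernoulliMgf.
Import boolp functions topology normedtype derive realfun.
Import numFieldNormedType.Exports.

Lemma ge0_of_derive_ge0 (R : realType) (f df : R -> R) (x : R) :
  0 <= x -> f 0 = 0 -> (forall y : R, 0 <= y -> is_derive y 1 f (df y)) ->
  (forall y : R, 0 <= y -> 0 <= df y) -> 0 <= f x.
Proof.
move=> x0 f0 fdf df0.
have [||c /itvP cx] := @MVT_segment R f df 0 x x0.
- by move=> y /itvP yx; apply: fdf; rewrite yx.
- apply: derivable_within_continuous => z /itvP zx.
  by have [] := fdf z (ltac:(by rewrite zx)).
- by rewrite f0 !subr0 => ->; rewrite mulr_ge0 // df0 // cx.
Qed.

(** The logarithm of the ratio of the right side to the left one vanishes at [l = 0] together with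
    its derivative [g], and its second derivative is nonnegative; two applications of the mean value
    theorem conclude. *)
Lemma bernoulli_mgf_ge0 (R : realType) (m l : R) : 0 <= m <= 1 -> 0 <= l ->
  1 - m + m * expR l <= expR (l * m + l ^+ 2 / 8).
Proof.
move=> /andP[m0 m1] l0.
pose u (x : R) : R := 1 - m + m * expR x.
have u0 : u 0 = 1 by rewrite /u expR0 mulr1 subrK.
have u_ge1 (x : R) : 0 <= x -> 1 <= u x.
  move=> x0; have e1 : 1 <= expR x by have := expR_ge1Dx x; lra.
  by rewrite /u; have := mulr_ge0 m0 (ltac:(lra) : 0 <= expR x - 1); lra.
have u_gt0 (x : R) : 0 <= x -> 0 < u x by move=> /u_ge1; lra.
have du (x : R) : is_derive x 1 u (m * expR x).
  have -> : u = (cst (1 - m) : R -> R) + m *: (expR : R -> R) by apply/funext.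
  apply: (is_derive_eq (is_deriveD (is_derive_cst _ _ _)
    (is_deriveZ m (is_derive_expR x)))).
  by rewrite add0r.
pose g (x : R) : R := x / 4 + m - 1 + (1 - m) / u x.
have g0 : g 0 = 0 by rewrite /g u0; lra.
have g_ge0 (x : R) : 0 <= x -> 0 <= g x.
  move=> x0; pose dg (x : R) : R := 4^-1 - (1 - m) * (m * expR x) / (u x ^+ 2).
  have dgP (y : R) : 0 <= y -> is_derive y 1 g (dg y).
    move=> y0; have uy : u y != 0 by rewrite gt_eqF // u_gt0.
    have -> : g = 4^-1 *: (id : R -> R) + (cst (m - 1) : R -> R) +
                  (1 - m) *: ((fun z => (u z)^-1) : R -> R).
      by apply/funext => z; rewrite /g !fctE /GRing.scale /=; ring.
    apply: (is_derive_eq (is_deriveD (is_deriveD (is_deriveZ _ (is_derive_id _ _))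
      (is_derive_cst _ _ _)) (is_deriveZ _ (is_deriveV uy (du y))))).
    by rewrite /dg /GRing.scale /=; field.
  have dg_ge0 (y : R) : 0 <= y -> 0 <= dg y.
    move=> y0; have uy := u_gt0 _ y0.
    rewrite /dg subr_ge0 ler_pdivrMr ?exprn_gt0 //.
    (* This is [(a + b)^2 >= 4 a b] for the two summands [1 - m] and [m * expR y] of [u y]. *)
    rewrite /u; have : 0 <= ((1 - m) - m * expR y) ^+ 2 by exact: sqr_ge0.
    lra.
  exact: ge0_of_derive_ge0 x0 g0 dgP dg_ge0.
pose f (x : R) : R := x * m + x ^+ 2 / 8 - ln (u x).
have f0 : f 0 = 0 by rewrite /f u0 ln1; lra.
have fP (y : R) : 0 <= y -> is_derive y 1 f (g y).
  move=> y0; have uy := u_gt0 _ y0.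
  have uy0 : u y != 0 by rewrite gt_eqF.
  have -> : f = m *: (id : R -> R) + 8^-1 *: ((id : R -> R) ^+ 2) - ((@ln R) \o u).
    by apply/funext => z; rewrite /f !fctE /GRing.scale /=; ring.
  apply: (is_derive_eq (is_deriveB (is_deriveD (is_deriveZ _ (is_derive_id _ _))
    (is_deriveZ _ (is_deriveX 2 (is_derive_id _ _))))
    (is_derive1_comp (is_derive1_ln uy) (du y)))).
  rewrite /g /GRing.scale /= expr1 !mulr1 -mulr_natr.
  by move: uy0; rewrite /u => uy0; field.
have f_ge0 := ge0_of_derive_ge0 l0 f0 fP g_ge0.
rewrite -[leLHS]/(u l) -[u l]lnK ?posrE ?u_gt0 // ler_expR.
by move: f_ge0; rewrite /f; lra.
Qed.

End BernoulliMgf.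

(** For [l < 0], exchanging the two outcomes replaces [m] by [1 - m] and [l] by [- l], up to a
    factor [expR l]. *)
Lemma bernoulli_mgf (R : realType) (m l : R) : 0 <= m <= 1 ->
  1 - m + m * expR l <= expR (l * m + l ^+ 2 / 8).
Proof.
move=> m01; have /andP[m0 m1] := m01; have [l0|l0] := leP 0 l.
  exact: bernoulli_mgf_ge0.
have := @bernoulli_mgf_ge0 R (1 - m) (- l) (ltac:(lra)) (ltac:(lra)).
rewrite -(ler_pM2l (expR_gt0 l)) -expRD.
rewrite (_ : l + (- l * (1 - m) + (- l) ^+ 2 / 8) = l * m + l ^+ 2 / 8); last by field.
apply: le_trans; rewrite expRN.
have := expR_gt0 l; set e := expR l => e0.
by rewrite le_eqVlt; apply/orP; left; apply/eqP; field; rewrite gt_eqF.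
Qed.

(** By convexity of the exponential, a variable in [[0, 1]] has a moment generating function at most
    that of the Bernoulli variable with the same mean. *)
Lemma hoeffding (R : realType) (I : finType) (p x : I -> R) (l : R) :
  (forall i, 0 <= p i) -> \sum_i p i = 1 -> (forall i, 0 <= x i <= 1) ->
  \sum_i p i * expR (l * (x i - \sum_j p j * x j) - l ^+ 2 / 8) <= 1.
Proof.
move=> p0 p1 x01; set m := \sum_j p j * x j.
have m01 : 0 <= m <= 1.
  apply/andP; split.
    by rewrite /m sumr_ge0 // => i _; have /andP[x0 _] := x01 i; rewrite mulr_ge0.
  by rewrite -p1; apply: ler_sum => i _; have /andP[_ x1] := x01 i; rewrite ler_piMr.
(* convexity: average the tangent inequality at [l * x i] over [0] and [l] *)
have cvx i : expR (l * x i) <= 1 - x i + x i * expR l.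
  have /andP[x0 x1] := x01 i.
  have e0 := expR_gt0 (l * x i).
  have E0 : expR (l * x i) * (1 - l * x i) <= 1.
    by rewrite -ler_pdivlMl // -expRN mulr1 expR_ge1Dx.
  have El : expR (l * x i) * (1 + (l - l * x i)) <= expR l.
    by rewrite -ler_pdivlMl // -expRN -expRD [- _ + l]addrC expR_ge1Dx.
  have x1' : 0 <= 1 - x i by lra.
  have := ler_wpM2l x1' E0; have := ler_wpM2l x0 El; lra.
have bound := bernoulli_mgf l m01.
apply: (@le_trans _ _ ((1 - m + m * expR l) * expR (- (l * m + l ^+ 2 / 8)))); last first.
  by rewrite -ler_pdivlMr ?expR_gt0 // expRN invrK mul1r.
have -> : 1 - m + m * expR l = \sum_i p i * (1 - x i + x i * expR l).
  have -> : 1 - m = \sum_i (p i - p i * x i) by rewrite sumrB p1.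
  rewrite /m mulr_suml -big_split /=; apply: eq_bigr => i _; ring.
rewrite mulr_suml; apply: ler_sum => i _.
rewrite (_ : l * (x i - m) - l ^+ 2 / 8 = l * x i - (l * m + l ^+ 2 / 8)); last by ring.
by rewrite expRD mulrA ler_wpM2r ?expR_ge0 // ler_wpM2l.
Qed.

Lemma ln2_ge (R : realType) : 2 / 3 <= ln (2 : R).
Proof.
rewrite -ler_expR lnK ?posrE ?ltr0n //.
(* Tenth power of [1 - 1 / 15 <= exp (- 1 / 15)]; the number [(14 / 15)^10] lies just above
   [1 / 2]. *)
have e : (14 / 15 : R) ^+ 10 <= expR (- (2 / 3)).
  rewrite (_ : - (2 / 3) = 10%:R * (- (1 / 15)) :> R); last by field.
  rewrite expRM_natl lerXn2r ?nnegrE ?expR_ge0 //; first by lra.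
  by apply: le_trans (expR_ge1Dx _); lra.
have : 2^-1 <= expR (- (2 / 3)) :> R by apply: le_trans e; lra.
by rewrite expRN lef_pV2 ?posrE ?expR_gt0.
Qed.

Lemma expR1_le3 (R : realType) : expR (1 : R) <= 3.
Proof.
have e : 3^-1 <= expR (- 1 : R).
  apply: (@le_trans _ _ ((5 / 6 : R) ^+ 6)); first by lra.
  rewrite (_ : - 1 = 6%:R * (- (1 / 6)) :> R); last by field.
  rewrite expRM_natl lerXn2r ?nnegrE ?expR_ge0 //; first by lra.
  by apply: le_trans (expR_ge1Dx _); lra.
by move: e; rewrite expRN lef_pV2 ?posrE ?expR_gt0.
Qed.

(** * The law of the delay path *)

(* The joint law of a process with sub-stochastic one-step laws [q i f], where
   [q i f] depends only on the coordinates of [f] below [i]. *)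
Lemma sum_prod_predictable_le1 (R : realDomainType) (X : finType) (N : nat)
    (q : 'I_N -> {ffun 'I_N -> X} -> X -> R) :
  (forall (i : 'I_N) (f g : {ffun 'I_N -> X}) x,
     (forall j : 'I_N, (j < i)%N -> f j = g j) -> q i f x = q i g x) ->
  (forall i f x, 0 <= q i f x) ->
  (forall i f, \sum_x q i f x <= 1) ->
  \sum_f \prod_i q i f (f i) <= 1.
Proof.
elim: N q => [|N IH] q q_pred q0 q1.
  rewrite (eq_bigr (fun=> 1)) => [|f _]; last by rewrite big_ord0.
  by rewrite sumr_const card_ffun card_ord expn0.
pose cons x (g : {ffun 'I_N -> X}) : {ffun 'I_N.+1 -> X} :=
  [ffun i => oapp g x (unlift ord0 i)].
have cons0 x g : cons x g ord0 = x by rewrite ffunE unlift_none.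
have consS x g j : cons x g (lift ord0 j) = g j by rewrite ffunE liftK.
pose dec (f : {ffun 'I_N.+1 -> X}) := (f ord0, [ffun j => f (lift ord0 j)]).
have decK : cancel dec (fun a => cons a.1 a.2).
  move=> f; apply/ffunP => i; rewrite ffunE /=.
  by case: unliftP => [j|] -> //=; rewrite ffunE.
have consK : cancel (fun a => cons a.1 a.2) dec.
  move=> [x g]; rewrite /dec cons0; congr (_, _).
  by apply/ffunP => j; rewrite ffunE consS.
rewrite (reindex (fun a : X * {ffun 'I_N -> X} => cons a.1 a.2)) /=; last first.
  by exists dec => ? _; [exact: consK | exact: decK].
rewrite -(pair_bigA _ (fun x g => \prod_i q i (cons x g) (cons x g i))) /=.
have [y0 _|noX] := pickP X; last first.
  by rewrite big1 ?ler01 // => x; have := noX x.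
(* By predictability the law of the first coordinate does not see the tail, so an arbitrary tail may
   be fixed. *)
have g0 : {ffun 'I_N -> X} := [ffun=> y0].
apply: (@le_trans _ _ (\sum_x q ord0 (cons y0 g0) x)); last exact: q1.
apply: ler_sum => x _.
rewrite (eq_bigr (fun g => q ord0 (cons y0 g0) x *
    \prod_(i < N) q (lift ord0 i) (cons x g) (g i))); last first.
  move=> g _; rewrite big_ord_recl cons0; congr (_ * _).
    exact: q_pred.
  by apply: eq_bigr => i _; rewrite consS.
rewrite -mulr_sumr ler_piMr //.
apply: (IH (fun i g y => q (lift ord0 i) (cons x g) y)) => // i f g y fg.
apply: q_pred => j ji; rewrite !ffunE; case: unliftP ji => //= k ->.
by rewrite /bump /= !add1n ltnS => /fg.
Qed.

Lemma onth_take (T : Type) (s : seq T) m n : (m < n)%N -> onth (take n s) m = onth s m.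
Proof. by move=> ltmn; rewrite !onthE map_take nth_take. Qed.

Section CSE.
Variables (R : realType) (K D T : nat) (B : R).
Implicit Types (d : nat -> nat) (arms : seq 'I_K) (S : {set 'I_K}).

Lemma eliminateS d arms t S : eliminate D T B d arms t S \subset S.
Proof. by apply/subsetP => i; rewrite inE => /andP[]. Qed.

Lemma steps_rcons arms a : steps (rcons arms a) = rcons (steps arms) ((size arms).+1, a).
Proof.
by rewrite /steps size_rcons -[X in iota 1 X]addn1 iotaD -cats1 zip_cat ?size_iota // cats1 add1n.
Qed.

Lemma mem_steps_le arms q : q \in steps arms -> (0 < q.1 <= size arms)%N.
Proof.
case: q => s i /(map_f fst); rewrite -/(unzip1 _) unzip1_zip ?size_iota //=.
by rewrite mem_iota add1n ltnS.
Qed.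

Lemma cse_loop_prefix fuel d t S arms :
  prefix arms (cse_loop D T B fuel d t S arms).2.
Proof.
elim: fuel t S arms => [|fuel IH] t S arms /=; first exact: prefix_refl.
case: ifP => _; last exact: prefix_refl.
case: ifP => _; first exact: prefix_prefix.
by apply: prefix_trans (IH _ _ _); exact: prefix_prefix.
Qed.

Lemma eq_eliminate d d' arms t S :
  (forall s, (s <= size arms)%N -> d s = d' s) ->
  eliminate D T B d arms t S = eliminate D T B d' arms t S.
Proof.
move=> dd'.
have dq q : q \in steps arms -> d q.1 = d' q.1.
  by move=> /mem_steps_le /andP[_ ?]; apply: dd'.
have EM i : M_t d arms t i = M_t d' arms t i.
  by rewrite /M_t; congr map; apply: eq_in_filter => q /dq ->.
have EO i : O_t d arms t i = O_t d' arms t i.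
  by rewrite /O_t; congr map; apply: eq_in_filter => q /dq ->.
have Ec (P : pred (nat * 'I_K)) :
    \sum_(s <- [seq q.1 | q <- steps arms & P q]) cost R D d s =
    \sum_(s <- [seq q.1 | q <- steps arms & P q]) cost R D d' s.
  rewrite !big_map !big_filter big_seq_cond [RHS]big_seq_cond.
  by apply: eq_bigr => q /andP[/dq e _]; rewrite /cost e.
have EF i : mu_F R D d arms t i = mu_F R D d' arms t i.
  by rewrite /mu_F Ec.
have Em i : mu_minus R D d arms t i = mu_minus R D d' arms t i.
  by rewrite /mu_minus EM -EO Ec.
apply/setP => i; rewrite !inE; congr (_ && ~~ _).
apply: eq_existsb => j; congr (_ && _).
by rewrite /LCB /L1 /L2 /L3 /UCB !EF Em EM.
Qed.

(** Either the current round already reaches play [s], and later rounds do not affect the prefix, or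
    it ends earlier, and its elimination reads only delays of steps before [s]. *)
Lemma cse_loop_predictable fuel d d' t S arms s :
  t = (size arms).+1 ->
  (forall r, (r < s)%N -> d r = d' r) ->
  take s (cse_loop D T B fuel d t S arms).2 = take s (cse_loop D T B fuel d' t S arms).2.
Proof.
move=> ->.
have E arms1 arms2 : prefix arms1 arms2 -> (s <= size arms1)%N -> take s arms2 = take s arms1.
  by move=> /prefixP[a ->] h; rewrite takel_cat.
elim: fuel S arms => [|fuel IH] S arms //= dd'.
case: ifP => // _.
rewrite addSn cardE -size_cat.
have [le_s|lt_s] := leqP s (size (arms ++ enum S)).
  by case: ifP => _; case: ifP => _; rewrite ?[LHS](E (arms ++ enum S))
    ?[RHS](E (arms ++ enum S)) ?prefix_refl ?cse_loop_prefix.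
rewrite (@eq_eliminate d d') => [|r r_le]; last by apply: dd'; apply: leq_ltn_trans lt_s.
by case: ifP => // _; apply: IH.
Qed.

(** The last round starts before time [T] and adds at most [K] plays, so every play has its own
    coordinate in the path. *)
Lemma cse_loop_size fuel d t S arms :
  t = (size arms).+1 -> (size arms <= T + K)%N ->
  (size (cse_loop D T B fuel d t S arms).2 <= T + K)%N.
Proof.
move=> ->; elim: fuel S arms => [|fuel IH] S arms //= sz.
case: ifP => // /ltnW ltT; rewrite addSn cardE -size_cat.
have le : (size (arms ++ enum S) <= T + K)%N.
  by rewrite size_cat -cardE leq_add ?(ltnW ltT) // -[X in (_ <= X)%N]card_ord max_card.
by case: ifP => // _; apply: IH.
Qed.


(** No index of this range reaches the default [z]; it is left free so as to match the factor of an
    unplayed coordinate. *)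
Lemma big_steps (F : nat -> 'I_K -> R) arms (z : nat -> R) :
  \prod_(q <- steps arms) F q.1 q.2 =
  \prod_(1 <= s < (size arms).+1) oapp (F s) (z s) (onth arms s.-1).
Proof.
elim/last_ind: arms => [|arms a IH]; first by rewrite /steps big_nil big_geq.
rewrite steps_rcons big_rcons IH size_rcons [RHS]big_nat_recr //=.
congr (_ * _); last by rewrite -cats1 onth_cat ltnn subnn.
apply: eq_big_nat => s /andP[s0 s_le]; rewrite -cats1 onth_cat.
by rewrite (_ : s.-1 < size arms)%N // prednK.
Qed.

(* The product of the [w] is a nonnegative supermartingale along the run: [w]
   weighs each play by its delay, given the arms played before it. *)
Lemma expectation_le1 (p : 'I_K -> 'I_D.+1 -> R) (w : seq 'I_K -> 'I_K -> nat -> R) :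
  (forall i x, 0 <= p i x) -> (forall pre i x, 0 <= w pre i x) ->
  (forall pre i, \sum_x p i x * w pre i x <= 1) ->
  \sum_(ds : {ffun 'I_(H K T).+1 -> 'I_D.+1}) path_weight B p ds *
    (let A := cse_arms K D T B (dfun ds) in
     \prod_(q <- steps A) w (take q.1.-1 A) q.2 (dfun ds q.1)) <= 1.
Proof.
move=> p0 w0 w1.
pose A (ds : {ffun 'I_(H K T).+1 -> 'I_D.+1}) := cse_arms K D T B (dfun ds).
(* One-step law: the weighted delay law of the arm played, or the point mass at [0] on an unplayed
   coordinate. *)
pose q (s : 'I_(H K T).+1) ds (x : 'I_D.+1) : R :=
  if (0 < s)%N then
    oapp (fun a => p a x * w (take s.-1 (A ds)) a x) (x == ord0)%:R (onth (A ds) s.-1)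
  else (x == ord0)%:R.
have qE ds : path_weight B p ds *
    (\prod_(q <- steps (A ds)) w (take q.1.-1 (A ds)) q.2 (dfun ds q.1)) =
    \prod_s q s ds (ds s).
  have szA : (size (A ds) <= H K T)%N by apply: cse_loop_size.
  rewrite (bigID (fun s : 'I__ => (1 <= s)%N && (s <= size (A ds))%N)) /=.
  rewrite /path_weight -/(A ds) mulrAC; congr (_ * _); last first.
    apply: eq_bigr => s; rewrite /q; case: posnP => //= s0.
    rewrite -ltnNge => lt_s; rewrite onth_default //; lia.
  rewrite -big_split /=.
  rewrite (big_steps (fun s a => p a (ds (inord s)) * w (take s.-1 (A ds)) a (dfun ds s)) _
    (fun s => (ds (inord s) == ord0)%:R)).
  rewrite [RHS](_ : _ = \prod_(s < (H K T).+1 | (1 <= s)%N && (s < (size (A ds)).+1)%N)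
    oapp (fun a => p a (ds (inord s)) * w (take s.-1 (A ds)) a (dfun ds s))
     (ds (inord s) == ord0)%:R (onth (A ds) s.-1)).
    rewrite [LHS](big_nat_widen _ _ (H K T).+1) ?ltnS // (big_nat_widenl 1 0) //.
    by rewrite big_mkord; apply: eq_bigl => s; rewrite andbC.
  apply: eq_big => [s|s /andP[s0 _]]; first by rewrite ltnS.
  by rewrite /q s0 inord_val /dfun inord_val.
rewrite (eq_bigr _ (fun ds _ => qE ds)).
apply: sum_prod_predictable_le1 => [s f g x fg|s f x|s f].
- rewrite /q; case: posnP => // s0.
  have E : take s (A f) = take s (A g).
    apply: cse_loop_predictable => // r rs; rewrite /dfun fg // inordK //.
    by apply: ltn_trans rs _.
  have s1 : (s.-1 < s)%N by rewrite prednK.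
  have E1 : take s.-1 (A f) = take s.-1 (A g).
    by rewrite -(take_takel _ (ltnW s1)) E take_takel // ltnW.
  suff -> : onth (A f) s.-1 = onth (A g) s.-1 by rewrite E1.
  by rewrite -(onth_take _ s1) E onth_take.
- rewrite /q; case: ifP => // _; case: onth => //= a; exact: mulr_ge0.
- have dirac1 : \sum_(x < D.+1) (x == ord0)%:R <= 1 :> R.
    by rewrite (bigD1 ord0) //= big1 ?addr0 // => i /negPf ->.
  by rewrite /q; case: (0 < s)%N => //; case: (onth (A f) s.-1) => //= a.
Qed.

End CSE.

(** * Tail bounds for the plays of one arm *)

Section Pulls.
Variables (R : realType) (K : nat).
Implicit Types (d : nat -> nat) (arms : seq 'I_K).

Definition pulls arms i : seq nat := [seq q.1 | q <- steps arms & q.2 == i].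

Lemma pulls_rcons arms a i :
  pulls (rcons arms a) i =
  if a == i then rcons (pulls arms i) (size arms).+1 else pulls arms i.
Proof. by rewrite /pulls steps_rcons filter_rcons /=; case: eqP => //; rewrite map_rcons. Qed.

Lemma size_pulls arms i : size (pulls arms i) = count_mem i arms.
Proof.
elim/last_ind: arms => //= arms a IH; rewrite pulls_rcons -[in RHS]cats1 count_cat -IH /= addn0.
by case: eqP; rewrite ?size_rcons ?addn1 ?addn0.
Qed.

Lemma mem_pulls arms i s : s \in pulls arms i -> (0 < s <= size arms)%N.
Proof. by move=> /mapP[q]; rewrite mem_filter => /andP[_ /mem_steps_le h] ->. Qed.

Lemma pulls_sorted arms i : sorted ltn (pulls arms i).
Proof.
elim/last_ind: arms => //= arms a IH; rewrite pulls_rcons; case: eqP => // _.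
case E : (pulls arms i) => [//|s l] /=; move: IH; rewrite E /= rcons_path => -> /=.
have : last s l \in pulls arms i by rewrite E mem_last.
by move=> /mem_pulls /andP[_]; rewrite ltnS.
Qed.

Lemma pulls_cat_prefix arms arms' i :
  exists2 l, pulls (arms ++ arms') i = pulls arms i ++ l & all (fun s => size arms < s)%N l.
Proof.
elim/last_ind: arms' => [|arms' a [l IH al]]; first by exists [::]; rewrite ?cats0.
rewrite -rcons_cat pulls_rcons; case: eqP => _; last by exists l.
exists (rcons l (size (arms ++ arms')).+1); first by rewrite IH rcons_cat.
by rewrite all_rcons al size_cat ltnS leq_addr.
Qed.

(** Events are stated on the complete run; this lemma and the next one transfer them to an
    intermediate state. *)
Lemma take_pulls_prefix arms A i n : prefix arms A ->
  (n <= size (pulls arms i))%N -> take n (pulls A i) = take n (pulls arms i).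
Proof.
by move=> /prefixP[l ->] h; have [l' -> _] := pulls_cat_prefix arms l i; rewrite takel_cat.
Qed.

Lemma filter_pulls_prefix arms A i : prefix arms A ->
  [seq s <- pulls A i | s < (size arms).+1]%N = pulls arms i.
Proof.
move=> /prefixP[l ->]; have [l' -> /allP al] := pulls_cat_prefix arms l i.
rewrite filter_cat -[RHS]cats0; congr (_ ++ _).
  by apply/all_filterP/allP => s /mem_pulls /andP[_]; rewrite ltnS.
apply/eqP; rewrite -[_ == _]negbK -has_filter; by apply/hasPn => s /al h; rewrite -leqNgt.
Qed.

Lemma prod_steps_pulls (b : nat -> bool) (h : nat -> R) arms i :
  \prod_(q <- steps arms) (if (q.2 == i) && b q.1 then expR (h q.1) else 1) =
  expR (\sum_(s <- pulls arms i | b s) h s).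
Proof. by rewrite expR_sum /pulls big_map big_filter_cond -big_mkcond. Qed.

(** Being among the first [n] plays is decided by the arms played before, so a weight stopped at the
    [n]-th play is predictable. *)
Lemma take_pulls arms i n :
  [seq s <- pulls arms i | count_mem i (take s.-1 arms) < n]%N = take n (pulls arms i).
Proof.
elim/last_ind: arms => //= arms a IH.
have E : [seq s <- pulls arms i | count_mem i (take s.-1 (rcons arms a)) < n]%N =
    take n (pulls arms i).
  rewrite -IH; apply: eq_in_filter => s /mem_pulls s_le.
  by rewrite -cats1 takel_cat //; lia.
rewrite pulls_rcons; case: eqP => // _; rewrite filter_rcons E /=.
rewrite -cats1 take_size_cat // -size_pulls.
case: ltnP => [lt_n|le_n]; first by rewrite !take_oversize // ?size_rcons // ltnW.
by rewrite -cats1 takel_cat.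
Qed.
End Pulls.

Section Prob.
Variables (R : realType) (K D T : nat) (B : R) (p : 'I_K -> 'I_D.+1 -> R).
Hypothesis D_gt0 : (0 < D)%N.
Hypothesis p_ge0 : forall i x, 0 <= p i x.
Hypothesis p_sum1 : forall i, \sum_(x < D.+1) p i x = 1.
Local Notation path := {ffun 'I_(H K T).+1 -> 'I_D.+1}.
Local Notation A ds := (cse_arms K D T B (dfun ds)).
Implicit Types ds : path.

Lemma path_weight_ge0 ds : 0 <= path_weight B p ds.
Proof. by rewrite /path_weight mulr_ge0 // prodr_ge0 // => q _; case: eqP. Qed.

Lemma mass_le1 : \sum_(ds : path) path_weight B p ds <= 1.
Proof.
have := @expectation_le1 R K D T B p (fun _ _ _ => 1) p_ge0 (fun _ _ _ => ler01).
rewrite (eq_bigr (path_weight B p)) => [|ds _]; last by rewrite /= big1 // mulr1.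
by apply=> _ i; rewrite (eq_bigr (p i)) ?p_sum1 // => x _; rewrite mulr1.
Qed.

(** Markov's inequality for the product of the weights, whose expectation is at most [1]. *)
Lemma markov_path (w : seq 'I_K -> 'I_K -> nat -> R) (E : pred path) (c : R) :
  (forall pre i x, 0 <= w pre i x) ->
  (forall pre i, \sum_x p i x * w pre i x <= 1) ->
  (forall ds, E ds ->
     expR c <= \prod_(q <- steps (A ds)) w (take q.1.-1 (A ds)) q.2 (dfun ds q.1)) ->
  \sum_(ds : path) path_weight B p ds * (E ds)%:R <= expR (- c).
Proof.
move=> w0 w1 Ew.
have le1 := @expectation_le1 R K D T B p w p_ge0 w0 w1.
rewrite expRN -(ler_pM2r (expR_gt0 c)) mulVf ?gt_eqF ?expR_gt0 //.
apply: le_trans le1; rewrite mulr_suml; apply: ler_sum => ds _; rewrite -mulrA.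
rewrite ler_wpM2l ?path_weight_ge0 //=.
case: (boolP (E ds)) => [/Ew|_]; first by rewrite mul1r.
by rewrite mul0r prodr_ge0.
Qed.

(* The sum is the logarithm of the exponential supermartingale with parameter
   [l], stopped at the [n]-th play of [i]. *)
Definition deviates (l : R) (n : nat) (i : 'I_K) (c : R) d arms : bool :=
  (n <= size (pulls arms i))%N &&
  (c <= \sum_(s <- take n (pulls arms i)) (l * (cost R D d s - mu p i) - l ^+ 2 / 8)).

Lemma cost01 (x : 'I_D.+1) : 0 <= (x%:R / D%:R : R) <= 1.
Proof. by rewrite divr_ge0 //= ler_pdivrMr ?ltr0n // mul1r ler_nat -ltnS. Qed.

(** The first [n] plays of [i] carry Hoeffding's factor as weight, all other plays the weight
    [1]. *)
Lemma prob_deviates l n i c :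
  \sum_(ds : path) path_weight B p ds * (deviates l n i c (dfun ds) (A ds))%:R <= expR (- c).
Proof.
pose w (pre : seq 'I_K) (a : 'I_K) (x : nat) : R :=
  if (a == i) && (count_mem i pre < n)%N
  then expR (l * (x%:R / D%:R - mu p i) - l ^+ 2 / 8) else 1.
apply: (@markov_path w).
- by move=> pre a x; rewrite /w; case: ifP => // _; exact: expR_ge0.
- move=> pre a; rewrite /w.
  case: (boolP ((a == i) && (count_mem i pre < n)%N)) => [/andP[/eqP -> _]|_].
    exact: (hoeffding l (p_ge0 i) (p_sum1 i) cost01).
  by rewrite (eq_bigr (p a)) ?p_sum1 // => x _; rewrite mulr1.
- move=> ds /andP[_ le_c]; rewrite /w.
  rewrite (prod_steps_pulls (fun s => count_mem i (take s.-1 (A ds)) < n)%N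
    (fun s => l * (cost R D (dfun ds) s - mu p i) - l ^+ 2 / 8)).
  by rewrite ler_expR -big_filter take_pulls.
Qed.

Definition tailp (i : 'I_K) (m : nat) : R := \sum_(x < D.+1) p i x * (m <= x)%:R.

(** The condition [s < t] makes the count the same on the complete run as on the state at time
    [t]. *)
Definition delayed (d : nat -> nat) (arms : seq 'I_K) i t : nat :=
  size [seq s <- pulls arms i | (s < t)%N && (t <= s + d s)%N].

Definition overdelayed (t : nat) (i : 'I_K) (c : R) d arms : bool :=
  c + 2 * \sum_(s <- pulls arms i | (s < t)%N) tailp i (t - s) < (delayed d arms i t)%:R.

(** A play that is pending with probability [r] gets a weight of mean [(1 + (e - 1) r) exp (- 2 r)],
    at most [1] because [e <= 3]. *)
Lemma prob_overdelayed t i c :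
  \sum_(ds : path) path_weight B p ds * (overdelayed t i c (dfun ds) (A ds))%:R <= expR (- c).
Proof.
pose w (pre : seq 'I_K) (a : 'I_K) (x : nat) : R :=
  if (a == i) && ((size pre).+1 < t)%N
  then expR ((t <= (size pre).+1 + x)%:R - 2 * tailp i (t - (size pre).+1)) else 1.
apply: (@markov_path w (fun ds => overdelayed t i c (dfun ds) (A ds)) c).
- by move=> pre a x; rewrite /w; case: ifP => // _; exact: expR_ge0.
- move=> pre a; rewrite /w.
  case: (boolP ((a == i) && ((size pre).+1 < t)%N)) => [/andP[/eqP -> lt_t]|_]; last first.
    by rewrite (eq_bigr (p a)) ?p_sum1 // => x _; rewrite mulr1.
  set s := (size pre).+1; set r := tailp i _.
  have E x : p i x * expR ((t <= s + x)%:R - 2 * r) =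
      (p i x + p i x * (t - s <= x)%:R * (expR 1 - 1)) * expR (- (2 * r)).
    rewrite expRD mulrA leq_subLR; congr (_ * _).
    by case: (t <= s + x)%N; rewrite ?mulr1n ?mulr0n ?expR0; ring.
  rewrite (eq_bigr _ (fun x _ => E x)) -mulr_suml big_split /= p_sum1 -mulr_suml -/r.
  rewrite -[leRHS](mulfV (x := expR (2 * r))) ?gt_eqF ?expR_gt0 // expRN.
  rewrite ler_wpM2r ?invr_ge0 ?expR_ge0 //.
  apply: le_trans (expR_ge1Dx _); rewrite lerD2l mulrC ler_wpM2r //.
    by apply: sumr_ge0 => x _; rewrite mulr_ge0.
  by have := expR1_le3 R; lra.
- move=> ds; rewrite /overdelayed => /ltW le_c.
  have -> : \prod_(q <- steps (A ds)) w (take q.1.-1 (A ds)) q.2 (dfun ds q.1) =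
    \prod_(q <- steps (A ds)) (if (q.2 == i) && (q.1 < t)%N then
      expR ((t <= q.1 + dfun ds q.1)%:R - 2 * tailp i (t - q.1)) else 1).
    rewrite big_seq_cond [RHS]big_seq_cond.
    apply: eq_bigr => -[s a] /andP[/mem_steps_le /= /andP[s0 s_le] _].
    by rewrite /w (_ : (size _).+1 = s) //= size_takel ?prednK // (leq_trans (leq_pred s)).
  rewrite (prod_steps_pulls (fun s => s < t)%N
    (fun s => (t <= s + dfun ds s)%:R - 2 * tailp i (t - s))).
  rewrite ler_expR sumrB -mulr_sumr lerBrDr; apply: le_trans le_c _.
  rewrite /delayed -natr_sum ler_nat -sum1_size big_filter big_mkcondr /=.
  by apply: leq_sum => s _; case: (t <= _)%N.
Qed.
End Prob.

(** * Round robin *)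

Section RoundRobin.
Variable K : nat.
Implicit Types (arms : seq 'I_K) (S : {set 'I_K}).

(** Active sets only shrink, so every past round contained all arms that are still active. Keeping
    just this inclusion makes the invariant stable under shrinking [S]. *)
Definition round_robin S arms : Prop :=
  exists2 rounds : seq {set 'I_K},
    arms = flatten (map (fun X : {set 'I_K} => enum X) rounds) &
    all (fun X : {set 'I_K} => S \subset X) rounds.

Lemma round_robin_nil S : round_robin S [::].
Proof. by exists [::]. Qed.

Lemma round_robinS S S' arms : S' \subset S -> round_robin S arms -> round_robin S' arms.
Proof.
move=> sub [l -> /allP al]; exists l => //; apply/allP => X /al.
exact: subset_trans.
Qed.

Lemma round_robin_cat S arms : round_robin S arms -> round_robin S (arms ++ enum S).
Proof.
move=> [l -> al]; exists (rcons l S); last by rewrite all_rcons subxx.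
by rewrite map_rcons flatten_rcons.
Qed.

Lemma count_enum_le1 S i m : (count_mem i (take m (enum S)) <= 1)%N.
Proof. by rewrite count_uniq_mem ?take_uniq ?enum_uniq // leq_b1. Qed.

Lemma count_enum S i : i \in S -> count_mem i (enum S) = 1%N.
Proof. by move=> iS; rewrite count_uniq_mem ?enum_uniq // mem_enum iS. Qed.

(** Complete rounds contain both arms once; only the truncated last round can separate them. *)
Lemma round_robin_prefix S arms i j m : round_robin S arms -> i \in S -> j \in S ->
  (count_mem i (take m arms) <= (count_mem j (take m arms)).+1)%N.
Proof.
move=> [l -> al] iS jS; elim: l m al => //= X l IH m /andP[SX al].
rewrite take_cat; case: ltnP => _.
  by rewrite (leq_trans (count_enum_le1 _ _ _)).
rewrite !count_cat !count_enum ?(subsetP SX) // !add1n ltnS; exact: IH.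
Qed.

(** Each complete round in the window has one play of [i] and at least [#|S|] steps; the truncated
    round at its start accounts for the subtracted play. *)
Lemma round_robin_window S arms i m : round_robin S arms -> i \in S ->
  ((count_mem i (drop m arms)).-1 * #|S| <= size arms - m)%N.
Proof.
move=> [l -> al] iS; elim/last_ind: l m al => //= l X IH m.
rewrite all_rcons map_rcons flatten_rcons => /andP[SX al].
have cX := subset_leq_card SX.
rewrite drop_cat size_cat -cardE; case: ltnP => [lt_m|le_m].
  rewrite count_cat count_enum ?(subsetP SX) // addn1 /=.
  have := IH m al; case: (count_mem i _) => [|c] /=; first by rewrite mul0n.
  by move=> h; rewrite mulSn addnC -(addnBAC _ (ltnW lt_m)) leq_add.
have : (count_mem i (drop (m - size (flatten (map (fun X : {set 'I_K} => enum X) l)))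
    (enum X)) <= 1)%N.
  by rewrite count_uniq_mem ?drop_uniq ?enum_uniq // leq_b1.
by case: (count_mem _ _) => [|[|c]].
Qed.

Lemma count_pulls_take arms i m :
  count (fun s => s <= m)%N (pulls arms i) = count_mem i (take m arms).
Proof.
elim/last_ind: arms => //= arms a IH; rewrite pulls_rcons -[in RHS]cats1.
have [le_m|lt_m] := leqP m (size arms).
  rewrite takel_cat // -IH; case: eqP => // _.
  by rewrite -cats1 count_cat /= ltnNge le_m !addn0.
rewrite take_oversize ?size_cat ?addn1 // count_cat /= addn0.
move: IH; rewrite (take_oversize (ltnW lt_m)) => <-.
by case: eqP => _; rewrite -?cats1 ?count_cat /= ?lt_m ?addn0.
Qed.

Lemma count_pulls_drop arms i m :
  count (fun s => m < s)%N (pulls arms i) = count_mem i (drop m arms).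
Proof.
apply/eqP; rewrite -(eqn_add2l (count_mem i (take m arms))) -count_cat cat_take_drop.
rewrite -count_pulls_take -size_pulls -(count_predC (fun s => s <= m)%N).
by rewrite eqn_add2l; apply/eqP/eq_count => s /=; rewrite ltnNge.
Qed.

End RoundRobin.

(** * Inequalities bounding the number of plays by the gap *)

Section RealBounds.
Variable R : realType.

(** The best arm may be one sample behind, whence [f.-1]; the missing sample costs the extra [g].
    The rest is the hypothesis squared. *)
Lemma samples_bound (L g : R) (f : nat) : 0 < g -> 0 <= L ->
  ((1 < f)%N -> g <= 4 * Num.sqrt (2 * L / f.-1%:R)) -> f%:R * g <= g + 32 * L / g.
Proof.
move=> g0 L0; case: f => [|[|f]] /= gf.
- by rewrite mul0r addr_ge0 ?divr_ge0 ?mulr_ge0 // ltW.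
- by rewrite mul1r lerDl divr_ge0 ?mulr_ge0 // ltW.
have {gf} := gf isT; set y := Num.sqrt _ => gy.
have y2 : y ^+ 2 = 2 * L / f.+1%:R by rewrite sqr_sqrtr // divr_ge0 ?mulr_ge0.
have y0 : 0 <= y by exact: sqrtr_ge0.
have f0 : 0 < f.+1%:R :> R by rewrite ltr0n.
have e : y ^+ 2 * f.+1%:R = 2 * L by rewrite y2 divfK // gt_eqF.
rewrite -[f.+2]addn1 natrD mulrDl mul1r addrC lerD2l ler_pdivlMr //.
rewrite -mulrA -expr2.
have : g ^+ 2 <= 16 * y ^+ 2.
  by rewrite (_ : 16 * y ^+ 2 = (4 * y) ^+ 2); [rewrite lerXn2r ?nnegrE; lra|ring].
by move=> h; have := ler_wpM2l (ltW f0) h; lra.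
Qed.

(* The first-order term is absorbed by AM-GM: [2 y <= g / 24 + 24 y^2 / g]. *)
Lemma delayed_bound (L g b x m : R) (n : nat) : (0 < n)%N -> 0 < g -> 0 <= L ->
  3 * b < g -> g - b <= 2 * Num.sqrt (2 * L / n%:R) + m / n%:R ->
  m <= 2 * b * x + 16 * L + 2 ->
  n%:R * g <= 77 * L / g + 16 / 5 * b * x + 26 * L + 16 / 5.
Proof.
move=> n0 g0 L0 bg; set y := Num.sqrt _ => gy mx.
have N0 : 0 < n%:R :> R by rewrite ltr0n.
have y2 : y ^+ 2 = 2 * L / n%:R by rewrite sqr_sqrtr // divr_ge0 ?mulr_ge0.
have e : y ^+ 2 * n%:R = 2 * L by rewrite y2 divfK // gt_eqF.
have amgm : 2 * y <= g / 24 + 24 * y ^+ 2 / g.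
  have e2 : 24 * y ^+ 2 / g * g = 24 * y ^+ 2 by rewrite divfK // gt_eqF.
  rewrite -(ler_pM2r g0) [leRHS]mulrDl e2.
  by have := sqr_ge0 (g - 24 * y); lra.
have h1 : n%:R * (g - b) <= n%:R * (g / 24) + 48 * L / g + m.
  have e3 : n%:R * (m / n%:R) = m by rewrite mulrC divfK // gt_eqF.
  have e4 : n%:R * (24 * y ^+ 2 / g) = 48 * L / g.
    by rewrite (_ : _ * _ = 24 * (y ^+ 2 * n%:R) / g); [rewrite e|]; ring.
  rewrite -[in leRHS]e3 -e4 -!mulrDr ler_wpM2l ?(ltW N0) //.
  by apply: le_trans gy _; rewrite lerD2r.
have h2 : n%:R * (3 * b) <= n%:R * g by rewrite ler_wpM2l // ltW.
have Lg : 0 <= L / g by rewrite divr_ge0 // ltW.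
by lra.
Qed.

End RealBounds.

(** * Confidence bounds on the good event *)

Lemma sorted_filter_leq (l : seq nat) (m : nat) : sorted ltn l ->
  [seq s <- l | s <= m]%N = take (count (fun s => s <= m)%N l) l.
Proof.
elim: l => //= a l IH al; case: leqP => [_|lt_m] /=.
  by rewrite IH ?(path_sorted al) // add1n.
have nl : {in l, forall s, (s <= m)%N = false}.
  move=> s sl; apply/negbTE; rewrite -ltnNge (ltn_trans lt_m) //.
  by have /allP := order_path_min ltn_trans al; apply.
rewrite (eq_in_filter nl) filter_pred0 add0n.
by rewrite (eq_in_count nl) count_pred0 take0.
Qed.

Section Estimates.
Variables (K D : nat).
Implicit Types (d : nat -> nat) (arms : seq 'I_K).

Lemma n_tE arms i : n_t arms (size arms).+1 i = size (pulls arms i).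
Proof.
rewrite /n_t /pulls size_map; congr size; apply: eq_in_filter => q /mem_steps_le.
by case/andP=> _ q_le; rewrite leqW.
Qed.

Lemma M_tE d arms i :
  M_t d arms (size arms).+1 i = [seq s <- pulls arms i | (size arms).+1 <= s + d s]%N.
Proof.
rewrite /M_t /pulls filter_map -filter_predI; congr map.
apply: eq_in_filter => q /mem_steps_le /andP[_ q_le].
by rewrite leqW //= andbC.
Qed.

Lemma O_tE d arms i :
  O_t d arms (size arms).+1 i = [seq s <- pulls arms i | ~~ ((size arms).+1 <= s + d s)]%N.
Proof.
rewrite /O_t /pulls filter_map -filter_predI; congr map.
apply: eq_in_filter => q /mem_steps_le /andP[_ q_le].
by rewrite leqW //= andbC ltnNge.
Qed.

(** Play times increase, so the plays at least [D] steps old form an initial segment, to which the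
    bounds on the first [n] plays apply. *)
Lemma F_tE arms i : F_t D arms (size arms).+1 i =
  take (count_mem i (take ((size arms).+1 - D) arms)) (pulls arms i).
Proof.
rewrite -count_pulls_take -sorted_filter_leq ?pulls_sorted //.
rewrite /F_t (_ : [seq s <- pulls _ _ | _] =
    [seq s <- pulls arms i | s + D <= (size arms).+1]%N).
  by rewrite /pulls filter_map -filter_predI.
by apply: eq_in_filter => s /mem_pulls /andP[s0 _]; apply/idP/idP; lia.
Qed.

Lemma size_F_t arms i :
  size (F_t D arms (size arms).+1 i) = count_mem i (take ((size arms).+1 - D) arms).
Proof.
by rewrite F_tE size_takel // -count_pulls_take count_size.
Qed.

Lemma delayedE d arms i :
  delayed d arms i (size arms).+1 = size (M_t d arms (size arms).+1 i).
Proof.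
rewrite /delayed M_tE; congr size; apply: eq_in_filter => s /mem_pulls /andP[_ s_le].
by rewrite ltnS s_le.
Qed.

End Estimates.

Section Confidence.
Variables (R : realType) (K D T : nat) (B : R) (p : 'I_K -> 'I_D.+1 -> R).
Hypothesis D_gt0 : (0 < D)%N.
Hypothesis p_ge0 : forall i x, 0 <= p i x.
Hypothesis p_sum1 : forall i, \sum_(x < D.+1) p i x = 1.
Local Notation L := (logT R T).
Hypothesis L_ge : 2 / 3 <= L.
Variable d : nat -> nat.
Hypothesis d_le : forall s, (d s <= D)%N.

(** The first clause covers all initial segments at once, because the number of samples behind an
    estimate is random. *)
Definition good (arms : seq 'I_K) : Prop :=
  (forall i n, (0 < n <= size (pulls arms i))%N ->
     `|\sum_(s <- take n (pulls arms i)) (cost R D d s - mu p i)|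
       <= n%:R * Num.sqrt (2 * L / n%:R)) /\
  (forall i, (delayed d arms i (size arms).+1)%:R <=
     16 * L + 2 * \sum_(s <- pulls arms i) tailp p i ((size arms).+1 - s)).

Variables (arms : seq 'I_K) (S : {set 'I_K}).
Hypothesis arms_good : good arms.
Hypothesis arms_rr : round_robin S arms.
Hypothesis arms_pos : forall i, i \in S -> (0 < count_mem i arms)%N.
Local Notation t := (size arms).+1.
Local Notation n i := (size (pulls arms i)).
Local Notation f i := (size (F_t D arms t i)).
Local Notation width k := (Num.sqrt (2 * L / k%:R)).

Lemma mu01 i : 0 <= mu p i <= 1.
Proof.
apply/andP; split.
  by apply: sumr_ge0 => x _; rewrite mulr_ge0 //; have /andP[] := cost01 R D_gt0 x.
rewrite -(p_sum1 i); apply: ler_sum => x _; rewrite ler_piMr //.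
by have /andP[] := cost01 R D_gt0 x.
Qed.

Lemma cost_le1 s : cost R D d s <= 1.
Proof. by rewrite /cost ler_pdivrMr ?ltr0n // mul1r ler_nat. Qed.

Lemma empirical_mean i k : (0 < k <= n i)%N ->
  `|(\sum_(s <- take k (pulls arms i)) cost R D d s) / k%:R - mu p i| <= width k.
Proof.
move=> k_le; have [/(_ i k k_le) h _] := arms_good.
have /andP[k0 kn] := k_le.
have K0 : 0 < k%:R :> R by rewrite ltr0n.
have -> : (\sum_(s <- take k (pulls arms i)) cost R D d s) / k%:R - mu p i =
    (\sum_(s <- take k (pulls arms i)) (cost R D d s - mu p i)) / k%:R.
  rewrite sumrB big_const_seq count_predT size_takel // iter_addr_0 mulrBl.
  by rewrite -[mu p i *+ k]mulr_natr mulfK // gt_eqF.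
by rewrite normf_div [X in _ / X]gtr0_norm // ler_pdivrMr // mulrC.
Qed.

Lemma size_pulls_gt0 i : i \in S -> (0 < n i)%N.
Proof. by rewrite size_pulls; exact: arms_pos. Qed.

Lemma mu_minusE i : (0 < n i)%N -> mu_minus R D d arms t i * (n i)%:R =
  \sum_(s <- pulls arms i) (if (t <= s + d s)%N then (t - s)%:R / D%:R else cost R D d s).
Proof.
move=> n0.
rewrite /mu_minus n_tE divfK ?pnatr_eq0 -?lt0n // M_tE O_tE !big_filter.
rewrite [RHS](bigID (fun s => t <= s + d s)%N) /=.
by congr (_ + _); apply: eq_bigr => s; [move=> ->|move=> /negPf ->].
Qed.

(** A pending play satisfies [t - s <= d s], so [mu_minus] is at most the empirical mean of all
    plays. *)
Lemma L1_le i : i \in S -> L1 R D T d arms t i <= mu p i.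
Proof.
move=> iS; have n0 := size_pulls_gt0 iS.
have N0 : 0 < (n i)%:R :> R by rewrite ltr0n.
have := @empirical_mean i (n i); rewrite n0 leqnn take_size => /(_ isT).
rewrite ler_norml => /andP[_ h].
rewrite /L1 n_tE.
suff : mu_minus R D d arms t i <= (\sum_(s <- pulls arms i) cost R D d s) / (n i)%:R by lra.
rewrite ler_pdivlMr // mu_minusE //; apply: ler_sum => s _; case: ifP => // le_t.
by rewrite ler_wpM2r ?invr_ge0 // ler_nat leq_subLR.
Qed.

(** Each pending play lowers the sum of costs by at most [1]. The width counts twice: as estimation
    error and as the term subtracted in [L1]. *)
Lemma L1_ge i : i \in S ->
  mu p i - 2 * width (n i) - (size (M_t d arms t i))%:R / (n i)%:R <= L1 R D T d arms t i.
Proof.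
move=> iS; have n0 := size_pulls_gt0 iS.
have N0 : 0 < (n i)%:R :> R by rewrite ltr0n.
have := @empirical_mean i (n i); rewrite n0 leqnn take_size => /(_ isT).
rewrite ler_norml => /andP[h _].
rewrite /L1 n_tE.
suff : (\sum_(s <- pulls arms i) cost R D d s) / (n i)%:R <=
    mu_minus R D d arms t i + (size (M_t d arms t i))%:R / (n i)%:R by lra.
rewrite ler_pdivrMr // mulrDl divfK ?gt_eqF // mu_minusE // M_tE size_filter -sum1_count natr_sum.
rewrite [X in _ + X]big_mkcond -big_split /=.
apply: ler_sum => s _; case: ifP => _; last by rewrite addr0.
by apply: le_trans (cost_le1 s) _; rewrite lerDr divr_ge0.
Qed.

Lemma mu_F_dev i : (0 < f i)%N -> `|mu_F R D d arms t i - mu p i| <= width (f i).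
Proof.
move=> f0; have f_le : (f i <= n i)%N by rewrite F_tE size_take_min geq_minr.
have nFE : nF D arms t i = f i by rewrite /nF (maxn_idPl _).
have FE : F_t D arms t i = take (f i) (pulls arms i) by rewrite {1}F_tE size_F_t.
by rewrite /mu_F nFE [X in \sum_(s <- X) _]FE empirical_mean // f0.
Qed.

(** Without samples the interval around the default estimate [0] has half-width at least [1], hence
    contains every mean. *)
Lemma mu_F0 i : f i = 0%N ->
  mu_F R D d arms t i = 0 /\ 1 <= Num.sqrt (2 * L / (nF D arms t i)%:R).
Proof.
move=> f0; have F0 : F_t D arms t i = [::] by apply/size0nil.
rewrite /mu_F /nF F0 big_nil mul0r max0n divr1; split=> //.
rewrite -{1}[1]sqrtr1 ler_sqrt; first by move: L_ge; lra. by move: L_ge; lra.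
Qed.

Lemma L2_le i : L2 R D T d arms t i <= mu p i.
Proof.
have /andP[m0 m1] := mu01 i; rewrite /L2; case: (posnP (f i)) => [f0|f0].
  by have [-> h] := mu_F0 f0; lra.
have := mu_F_dev f0; rewrite /nF (maxn_idPl f0) ler_norml => /andP[_]; lra.
Qed.

Lemma UCB_ge i : mu p i <= UCB R D T d arms t i.
Proof.
have /andP[m0 m1] := mu01 i; rewrite /UCB; case: (posnP (f i)) => [f0|f0].
  by have [-> h] := mu_F0 f0; lra.
have := mu_F_dev f0; rewrite /nF (maxn_idPl f0) ler_norml => /andP[h _]; lra.
Qed.

Lemma L2_ge i : (0 < f i)%N -> mu p i - 2 * width (f i) <= L2 R D T d arms t i.
Proof.
move=> f0; have := mu_F_dev f0.
rewrite /L2 /nF (maxn_idPl f0) ler_norml => /andP[h _]; lra.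
Qed.

Lemma UCB_le i : (0 < f i)%N -> UCB R D T d arms t i <= mu p i + 2 * width (f i).
Proof.
move=> f0; have := mu_F_dev f0.
rewrite /UCB /nF (maxn_idPl f0) ler_norml => /andP[_ h]; lra.
Qed.

Lemma window_count i m : i \in S ->
  (count_mem i (drop m arms))%:R <= 1 + (size arms - m)%:R / (#|S|)%:R :> R.
Proof.
move=> iS; have S0 : 0 < (#|S|)%:R :> R by rewrite ltr0n card_gt0; apply/set0Pn; exists i.
have := round_robin_window m arms_rr iS; case: (count_mem _ _) => [|c] /=.
  by move=> _; rewrite addr_ge0 ?divr_ge0.
by move=> h; rewrite -add1n natrD lerD2l ler_pdivlMr // -natrM ler_nat.
Qed.

(** The tail probabilities of the plays sum to at most [1 + D mu / |S|], so the good event gives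
    [m <= 16 L + 2 + 2 D mu / |S|]; solving for [mu] yields [L3]. *)
Lemma L3_le i : i \in S -> L3 R D T d arms t S i <= mu p i.
Proof.
move=> iS; have S0 : 0 < (#|S|)%:R :> R by rewrite ltr0n card_gt0; apply/set0Pn; exists i.
have D0 : 0 < D%:R :> R by rewrite ltr0n.
have [_ /(_ i)] := arms_good; rewrite delayedE.
set m := (size _)%:R => m_le.
have tail_le : \sum_(s <- pulls arms i) tailp p i (t - s) <= 1 + D%:R * mu p i / (#|S|)%:R.
  (* Exchanging the sums turns the tail sum into the mean, over the delay [x],
     of the number of plays during the last [x] steps. *)
  rewrite /tailp exchange_big /=.
  have -> : 1 + D%:R * mu p i / (#|S|)%:R =
      \sum_(x < D.+1) p i x * (1 + x%:R / (#|S|)%:R) :> R.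
    rewrite -{1}(p_sum1 i) /mu mulr_sumr mulr_suml -big_split /=.
    apply: eq_bigr => x _; rewrite mulrDr mulr1; congr (_ + _).
    by field; rewrite !gt_eqF.
  apply: ler_sum => x _; rewrite -mulr_sumr ler_wpM2l //.
  have -> : \sum_(s <- pulls arms i) (t - s <= x)%:R =
      (count_mem i (drop (size arms - x) arms))%:R :> R.
    rewrite -count_pulls_drop -natr_sum -sum1_count; congr _%:R; rewrite [RHS]big_mkcond /=.
    rewrite big_seq [RHS]big_seq; apply: eq_bigr => s /mem_pulls /andP[s0 _].
    by rewrite leq_subLR ltn_psubLR // addnC; case: ifP.
  apply: le_trans (window_count _ iS) _.
  rewrite lerD2l ler_wpM2r ?invr_ge0 ?ler0n // ler_nat; lia.
have h : m / 2 - 8 * L - 1 <= D%:R * mu p i / (#|S|)%:R by lra.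
have e : (#|S|)%:R / D%:R * (D%:R * mu p i / (#|S|)%:R) = mu p i.
  by field; rewrite !gt_eqF.
by rewrite /L3 -/m -[leRHS]e ler_wpM2l // divr_ge0 // ltW.
Qed.

Lemma LCB_le i : i \in S -> LCB R D T d arms t S i <= mu p i.
Proof. by move=> iS; rewrite /LCB !ge_max L1_le // L2_le L3_le. Qed.

End Confidence.

(** * Regret on the good event *)

Section SumCount.
Variables (R : realType) (K : nat).

Lemma sum_count (F : 'I_K -> R) (A : seq 'I_K) :
  \sum_(a <- A) F a = \sum_i (count_mem i A)%:R * F i.
Proof.
elim: A => [|a A IH]; first by rewrite big_nil big1 // => i _; rewrite mul0r.
rewrite big_cons IH (bigD1 a) //= [RHS](bigD1 a) //= eqxx natrD mulrDl mul1r addrA.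
by congr (_ + _); apply: eq_bigr => i /negPf ia; rewrite eq_sym ia.
Qed.

Lemma sum_le_count (F : 'I_K -> R) (A : seq 'I_K) m : (forall i, 0 <= F i) ->
  (forall i, (count_mem i A <= m)%N) -> \sum_(a <- A) F a <= m%:R * \sum_i F i.
Proof.
move=> F0 Am; rewrite sum_count mulr_sumr; apply: ler_sum => i _.
by rewrite ler_wpM2r // ler_nat.
Qed.

End SumCount.

(** * Harmonic sums *)

Section Harmonic.
Variable R : realType.

Definition harmonic_sum (n : nat) : R := \sum_(1 <= j < n.+1) j%:R^-1.

Lemma harmonic_sumS n : harmonic_sum n.+1 = harmonic_sum n + n.+1%:R^-1.
Proof. by rewrite /harmonic_sum big_nat_recr. Qed.

(** Each term [1 / j] with [m < j <= n] is at least [1 / n]. This pays for removing [n - m] of [n]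
    active arms at once. *)
Lemma harmonic_sum_gap m n : (m <= n)%N ->
  harmonic_sum m + (n - m)%:R / n%:R <= harmonic_sum n.
Proof.
move=> /subnKC <-; elim: (n - m)%N => [|k IH]; first by rewrite addn0 subnn mul0r addr0.
rewrite addnS harmonic_sumS; apply: le_trans (lerD IH (lexx _)).
rewrite -addrA lerD2l addnC -addSn !addnK -[k.+1]addn1 natrD mulrDl mul1r lerD2r.
case: k {IH} => [|k]; first by rewrite !mul0r.
by rewrite ler_wpM2l // lef_pV2 ?posrE ?ltr0n // ler_nat addn1.
Qed.

Lemma harmonic_sum_ge1 n : (0 < n)%N -> 1 <= harmonic_sum n.
Proof.
move=> n0; have := harmonic_sum_gap n0; rewrite /harmonic_sum big_nat1 invr1.
by apply: le_trans; rewrite lerDl divr_ge0.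
Qed.

Lemma harmonic_sum_le_ln n : (0 < n)%N -> harmonic_sum n <= 1 + ln (n%:R : R).
Proof.
case: n => // n _; elim: n => [|n IH].
  by rewrite /harmonic_sum big_nat1 invr1 ln1 addr0.
rewrite harmonic_sumS; apply: le_trans (lerD IH (lexx _)) _.
rewrite -addrA lerD2l.
have n1 : 0 < n.+1%:R :> R by rewrite ltr0n.
have n2 : 0 < n.+2%:R :> R by rewrite ltr0n.
(* The increment of the logarithm is [- ln (1 - 1 / (n + 2))], at least the new term
   [1 / (n + 2)]. *)
have := @le_ln1Dx R (- n.+2%:R^-1).
rewrite (_ : 1 + - n.+2%:R^-1 = n.+1%:R / n.+2%:R); last first.
  rewrite -[n.+2%:R]natr1; move: n1; move: n.+1%:R => x x0.
  by field; rewrite gt_eqF // addr_gt0.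
rewrite ln_div ?posrE // ltrN2 invf_lt1 // ltr1n => /(_ isT).
by move: (ln n.+1%:R) (ln n.+2%:R) (n.+2%:R^-1) => a b c; lra.
Qed.

(** Since [ln n >= ln 2 >= 2 / 3], the constant [1] is at most [3 / 2 * ln n]. *)
Lemma harmonic_sum_ln n : (1 < n)%N -> harmonic_sum n <= 5 / 2 * ln (n%:R : R).
Proof.
move=> n1; apply: le_trans (harmonic_sum_le_ln (ltnW n1)) _.
have : ln (2 : R) <= ln n%:R by rewrite ler_ln ?posrE ?ltr0n ?ler_nat // ltnW.
by have := ln2_ge R; lra.
Qed.

End Harmonic.

(** * Number of plays of a surviving arm *)

Section Survivor.
Variables (R : realType) (K D T : nat) (B : R) (p : 'I_K -> 'I_D.+1 -> R) (istar : 'I_K).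
Hypothesis D_gt0 : (0 < D)%N.
Hypothesis p_ge0 : forall i x, 0 <= p i x.
Hypothesis p_sum1 : forall i, \sum_(x < D.+1) p i x = 1.
Hypothesis istar_opt : forall i, mu p istar <= mu p i.
Hypothesis B_gt0 : 0 < B.
Local Notation L := (logT R T).
Hypothesis L_ge : 2 / 3 <= L.
Variable d : nat -> nat.
Hypothesis d_le : forall s, (d s <= D)%N.
Implicit Types (arms : seq 'I_K) (S : {set 'I_K}).
Local Notation gap := (gap p istar).
Local Notation cap := (Num.min B (D%:R * gapmax p istar)).
Local Notation c0 := (16 / 5 * D%:R * cap).

Lemma gap_ge0 i : 0 <= gap i.
Proof. by rewrite subr_ge0. Qed.

Lemma gap_le1 i : gap i <= 1.
Proof.
have /andP[_ m1] := mu01 D_gt0 p_ge0 p_sum1 i.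
have /andP[m0 _] := mu01 D_gt0 p_ge0 p_sum1 istar.
by rewrite /Defs.gap; lra.
Qed.

Lemma gap_le_capacity i : gap i <= D%:R * gapmax p istar.
Proof.
have h : gap i <= gapmax p istar by rewrite /gapmax le_bigmax.
apply: le_trans h _; rewrite ler_peMl ?ler1n // (le_trans (gap_ge0 i)) //.
by rewrite /gapmax le_bigmax.
Qed.

Lemma cap_ge0 : 0 <= cap.
Proof. by rewrite le_min ltW // (le_trans (gap_ge0 istar)) // gap_le_capacity. Qed.

Lemma gap_le_logT i : 0 < gap i -> gap i <= 3 / 2 * (L / gap i).
Proof.
move=> g0; rewrite mulrA ler_pdivlMr //; have g1 := gap_le1 i.
have : gap i * gap i <= 1 * 1 by rewrite ler_pM // ltW.
by move: L_ge; lra.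
Qed.

(** The successor on the count pays in advance for the next round, at whose end the arm may be
    removed. *)
Lemma survivor_bound arms S i :
  good T p d arms -> round_robin S arms -> (forall j, j \in S -> (0 < count_mem j arms)%N) ->
  istar \in S \/ B < mu p istar ->
  i \in eliminate D T B d arms (size arms).+1 S -> 0 < gap i ->
  (count_mem i arms).+1%:R * gap i <= 110 * (L / gap i) + c0 / (#|S|)%:R.
Proof.
move=> gd rr pos star; rewrite inE => /andP[iS /existsPn surv] g0.
set t := (size arms).+1 in surv *; set g := gap i in g0 *; rewrite -size_pulls.
have S0 : 0 < (#|S|)%:R :> R by rewrite ltr0n card_gt0; apply/set0Pn; exists i.
have D0 : 0 < D%:R :> R by rewrite ltr0n.
have surv_le j : j \in S -> LCB R D T d arms t S i <= Num.min (UCB R D T d arms t j) B.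
  by move=> jS; have := surv j; rewrite jS /= -leNgt.
have LCB_B : LCB R D T d arms t S i <= B.
  by have := surv_le i iS; rewrite le_min => /andP[].
have [L1_LCB L2_LCB L3_LCB] : [/\ L1 R D T d arms t i <= LCB R D T d arms t S i,
    L2 R D T d arms t i <= LCB R D T d arms t S i
    & L3 R D T d arms t S i <= LCB R D T d arms t S i].
  by rewrite /LCB; split; rewrite !le_max lexx ?orbT.
have gE : g = mu p i - mu p istar by [].
have gcap := gap_le_capacity i; rewrite -/g in gcap.
have g_X := gap_le_logT g0; rewrite -/g in g_X.
have g1 := gap_le1 i; rewrite -/g in g1.
have /andP[ms0 _] := mu01 D_gt0 p_ge0 p_sum1 istar.
have L_X : L <= L / g by rewrite ler_pdivlMr // ler_piMr //; move: L_ge; lra.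
have X0 : 2 / 3 <= L / g by move: L_ge; lra.
have L0 : 0 <= L by move: L_ge; lra.
have [gB|gB] := leP g (3 * B).
- have f_bound : (size (F_t D arms t i))%:R * g <= g + 32 * L / g.
    apply: samples_bound => // f1.
    set f := size _ in f1 *.
    have f0 : (0 < f)%N by apply: ltnW.
    have f10 : (0 < f.-1)%N by rewrite -ltnS prednK.
    have w_mono k : (f.-1 <= k)%N ->
        Num.sqrt (2 * L / k%:R) <= Num.sqrt (2 * L / f.-1%:R).
      move=> fk; have k0 := leq_trans f10 fk.
      rewrite ler_wsqrtr // ler_wpM2l ?mulr_ge0 // lef_pV2 ?posrE ?ltr0n //.
      by rewrite ler_nat.
    have := L2_ge gd f0; rewrite -/t -/f => l2.
    have w1 := w_mono f (leq_pred _).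
    (* When [B < mu istar], the chain [L2 <= B < mu istar] already bounds the gap by two widths. *)
    have [sS|Bs] := star; last first.
      have := sqrtr_ge0 (2 * L / f.-1%:R); rewrite gE; lra.
    have fs : (f.-1 <= size (F_t D arms t istar))%N.
      rewrite -ltnS prednK // /f !size_F_t.
      exact: round_robin_prefix rr iS sS.
    have := surv_le istar sS; rewrite le_min => /andP[ucb _].
    have := UCB_le gd (leq_trans f10 fs); rewrite -/t => us.
    have w2 := w_mono _ fs.
    by rewrite gE; lra.
  have n_le : (size (pulls arms i))%:R <= (size (F_t D arms t i))%:R + (1 + D%:R / (#|S|)%:R) :> R.
    rewrite size_pulls -{1}(cat_take_drop (t - D) arms) count_cat natrD size_F_t lerD2l.
    apply: le_trans (window_count R rr _ iS) _.
    rewrite lerD2l ler_wpM2r ?invr_ge0 ?ler0n // ler_nat leq_subLR.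
    by rewrite (leq_trans (leqnSn _)) // addnC -leq_subLR.
  have cap_g : g <= 3 * cap.
    by rewrite /Num.min; case: ifP => _ //; have := gap_ge0 i; rewrite -/g; lra.
  have h1 : D%:R / (#|S|)%:R * g <= D%:R / (#|S|)%:R * (3 * cap).
    by rewrite ler_wpM2l // divr_ge0 // ltW.
  have h2 := ler_wpM2r (ltW g0) n_le.
  have h3 : 0 <= D%:R / (#|S|)%:R * cap by rewrite mulr_ge0 ?cap_ge0 ?divr_ge0 // ltW.
  have -> : c0 / (#|S|)%:R = 16 / 5 * (D%:R / (#|S|)%:R * cap) by ring.
  (* Three copies of [g] arise, from [f_bound], from the window and from the successor; each is at
     most [3 / 2 * L / g]. *)
  by rewrite -natr1; lra.
(* The minimum is [B] because [3 * B < g <= D * gapmax]. *)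
- have capB : cap = B by apply/min_idPl; move: B_gt0; lra.
  have n0 : (0 < size (pulls arms i))%N by rewrite size_pulls pos.
  have l1 := L1_ge D_gt0 d_le gd pos iS; rewrite -/t in l1.
  have m_le : (size (M_t d arms t i))%:R <= 2 * B * (D%:R / (#|S|)%:R) + 16 * L + 2.
    have := le_trans L3_LCB LCB_B; rewrite /L3.
    set m := (size _)%:R => l3.
    have : m / 2 - 8 * L - 1 <= B * (D%:R / (#|S|)%:R).
      rewrite -(ler_pM2l (divr_gt0 S0 D0)); apply: le_trans l3 _.
      by rewrite le_eqVlt; apply/orP; left; apply/eqP; field; rewrite !gt_eqF.
    lra.
  have := delayed_bound n0 g0 L0 gB _ m_le => /(_ (ltac:(rewrite gE; lra))).
  rewrite capB (_ : 16 / 5 * D%:R * B / (#|S|)%:R = 16 / 5 * B * (D%:R / (#|S|)%:R)); last by ring.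
  (* The constant 110 covers [77 + 26 + 24 / 5 + 3 / 2], from [L <= L / g], [2 / 3 <= L / g] and
     [g <= 3 / 2 * L / g]. *)
  by rewrite -natr1; lra.
Qed.

End Survivor.

(** * Induction over the elimination rounds *)

Section Loop.
Variables (R : realType) (K D T : nat) (B : R) (p : 'I_K -> 'I_D.+1 -> R) (istar : 'I_K).
Hypothesis D_gt0 : (0 < D)%N.
Hypothesis p_ge0 : forall i x, 0 <= p i x.
Hypothesis p_sum1 : forall i, \sum_(x < D.+1) p i x = 1.
Hypothesis istar_opt : forall i, mu p istar <= mu p i.
Hypothesis B_gt0 : 0 < B.
Local Notation L := (logT R T).
Hypothesis L_ge : 2 / 3 <= L.
Variable d : nat -> nat.
Hypothesis d_le : forall s, (d s <= D)%N.
Implicit Types (arms : seq 'I_K) (S : {set 'I_K}).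
Local Notation gap := (gap p istar).
Local Notation cap := (Num.min B (D%:R * gapmax p istar)).
Local Notation c0 := (16 / 5 * D%:R * cap).
Local Notation C i := (110 * (L / gap i)).

Lemma count_round S arms i :
  count_mem i (arms ++ enum S) = (count_mem i arms + (i \in S))%N.
Proof. by rewrite count_cat (count_uniq_mem _ (enum_uniq _)) mem_enum. Qed.

Lemma c0_ge0 : 0 <= c0.
Proof.
by rewrite mulr_ge0 ?mulr_ge0 // ?invr_ge0 //; exact: cap_ge0 D_gt0 istar_opt B_gt0.
Qed.

Lemma C_ge0 i : 0 <= C i.
Proof.
rewrite mulr_ge0 // divr_ge0 //; first by move: L_ge; lra.
exact: gap_ge0 istar_opt i.
Qed.

(** On the good event [LCB] of the best arm is at most [mu istar], hence below every [UCB]; only the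
    threshold [B] can remove it. *)
Lemma star_survives S arms :
  good T p d arms -> round_robin S arms -> (forall j, j \in S -> (0 < count_mem j arms)%N) ->
  istar \in S \/ B < mu p istar ->
  istar \in eliminate D T B d arms (size arms).+1 S \/ B < mu p istar.
Proof.
move=> gd rr pos [sS|]; last by right.
case: (boolP (istar \in eliminate D T B d arms (size arms).+1 S)); first by left.
rewrite inE sS /= negbK => /existsP[j /andP[jS]].
rewrite gt_min => /orP[|] h; right.
  have := LCB_le D_gt0 p_ge0 p_sum1 L_ge gd rr pos sS.
  have := UCB_ge D_gt0 p_ge0 p_sum1 L_ge gd j.
  have := istar_opt j.
  by move=> a b c; have := lt_le_trans h c; rewrite ltNge (le_trans a b).
exact: lt_le_trans h (LCB_le D_gt0 p_ge0 p_sum1 L_ge gd rr pos sS).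
Qed.

Lemma sum_active (S : {set 'I_K}) (x : 'I_K -> R) (m : nat) : (#|S| <= m)%N -> (0 < m)%N ->
  (forall i, i \in S -> x i <= C i + c0 / m%:R) ->
  \sum_(i in S) x i <= \sum_(i in S) C i + c0 * (#|S|%:R / m%:R).
Proof.
move=> Sm m0 h; apply: le_trans (ler_sum _ h) _.
rewrite big_split /= sumr_const -mulr_natr lerD2l le_eqVlt.
by apply/orP; left; apply/eqP; ring.
Qed.

(** The last hypothesis bounds the cost of each active arm including its next play. Arms removed in
    a round keep their counts and pay [c0 / |S|] each, which the harmonic sum loses between [|S|]
    and [|S'|]. *)
Lemma loop_regret fuel S arms :
  let A := (cse_loop D T B fuel d (size arms).+1 S arms).2 in
  (forall arms', prefix arms' A -> good T p d arms') ->
  round_robin S arms -> istar \in S \/ B < mu p istar -> S != set0 ->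
  (forall i, i \in S -> (count_mem i arms).+1%:R * gap i <= C i + c0 / (#|S|)%:R) ->
  \sum_(i in S) (count_mem i A)%:R * gap i <= \sum_(i in S) C i + c0 * harmonic_sum R #|S|
  /\ (forall i, i \notin S -> count_mem i A = count_mem i arms).
Proof.
have c00 := c0_ge0.
(* When the run ends, the remaining arms pay [c0 / |S'|] each, in total [c0], and the harmonic sum
   is at least [1]. *)
have stop S' x : S' != set0 ->
    (forall i, i \in S' -> x i <= C i + c0 / (#|S'|)%:R) ->
    \sum_(i in S') x i <= \sum_(i in S') C i + c0 * harmonic_sum R #|S'|.
  rewrite -card_gt0 => S'0 h; apply: le_trans (sum_active (leqnn _) S'0 h) _.
  by rewrite lerD2l ler_wpM2l // divff ?harmonic_sum_ge1 // pnatr_eq0 -lt0n.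
elim: fuel S arms => [|fuel IH] S arms /=.
  move=> _ _ _ S0 cnt; split=> //; apply: stop => // i iS.
  apply: le_trans (cnt i iS); rewrite ler_wpM2r ?ler_nat //.
  exact: gap_ge0 istar_opt i.
case: ifP => _; last first.
  move=> _ _ _ S0 cnt; split=> //; apply: stop => // i iS.
  apply: le_trans (cnt i iS); rewrite ler_wpM2r ?ler_nat //.
  exact: gap_ge0 istar_opt i.
rewrite addSn cardE -size_cat -cardE.
set arms' := arms ++ enum S; set S' := eliminate _ _ _ _ _ _ _.
have cnt' i : i \in S -> count_mem i arms' = (count_mem i arms).+1.
  by move=> iS; rewrite count_round iS addn1.
have cntN i : i \notin S -> count_mem i arms' = count_mem i arms.
  by move=> /negPf iS; rewrite count_round iS addn0.
case: eqP => [S'0|/eqP S'0] /=.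
  move=> _ _ _ S0 cnt; split=> //; apply: stop => // i iS.
  by rewrite cnt' // cnt.
move=> gd rr star S0 cnt.
have S'S : S' \subset S by exact: eliminateS.
have rr' : round_robin S arms' by exact: round_robin_cat.
have pos' j : j \in S -> (0 < count_mem j arms')%N by move=> jS; rewrite cnt'.
have gd' : good T p d arms' by apply: gd; exact: cse_loop_prefix.
have Sc0 : (0 < #|S|)%N by rewrite card_gt0.
have S'c0 : (0 < #|S'|)%N by rewrite card_gt0.
have cards := subset_leq_card S'S.
have [] := IH S' arms' gd (round_robinS S'S rr') (star_survives gd' rr' pos' star) S'0.
  move=> i iS'; have [g0|] := ltP 0 (gap i).
    have := survivor_bound D_gt0 p_ge0 p_sum1 istar_opt B_gt0 L_ge d_le gd' rr' pos' star iS' g0.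
    move/le_trans; apply; rewrite lerD2l ler_wpM2l // lef_pV2 ?posrE ?ltr0n //.
    by rewrite ler_nat.
  move=> g_le0; apply: (@le_trans _ _ 0); first by rewrite mulr_ge0_le0.
  by rewrite addr_ge0 ?C_ge0 // divr_ge0.
set A := (cse_loop _ _ _ _ _ _ _ _).2 => sumS' cntS'.
split; last first.
  move=> i iS; rewrite cntS' ?cntN //.
  by apply: contra iS => /(subsetP S'S).
have splitS (x : 'I_K -> R) : \sum_(i in S) x i = \sum_(i in S') x i + \sum_(i in S :\: S') x i.
  rewrite (big_setID S') /=; congr (_ + _); apply: eq_bigl => i.
  by rewrite (setIidPr S'S).
have sumD : \sum_(i in S :\: S') (count_mem i A)%:R * gap i <=
    \sum_(i in S :\: S') C i + c0 * (#|S :\: S'|%:R / #|S|%:R).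
  apply: sum_active => //; first by rewrite subset_leq_card ?subsetDl.
  by move=> i; rewrite inE => /andP[iS' iS]; rewrite cntS' // cnt' // cnt.
rewrite !splitS.
have := harmonic_sum_gap R cards; rewrite -(cardsDS S'S) => /(ler_wpM2l c00).
by rewrite mulrDr; lra.
Qed.

Lemma cse_regret_good :
  (forall arms, prefix arms (cse_arms K D T B d) -> good T p d arms) ->
  \sum_(a <- cse_arms K D T B d) gap a <= \sum_i C i + c0 * harmonic_sum R K.
Proof.
move=> gd.
rewrite sum_count.
have K0 : (0 < K)%N by apply: leq_ltn_trans (ltn_ord istar).
have := @loop_regret T.+1 [set: 'I_K] [::] gd (round_robin_nil _) (or_introl (in_setT _)).
rewrite -card_gt0 cardsT card_ord => /(_ K0)[|h _].
  move=> i _; rewrite mul1r; have [g0|g0] := ltP 0 (gap i); last first.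
    by apply: le_trans g0 _; rewrite addr_ge0 ?C_ge0 // divr_ge0 // c0_ge0.
  apply: le_trans (gap_le_logT D_gt0 p_ge0 p_sum1 L_ge g0) _.
  have := C_ge0 i; have : 0 <= c0 / K%:R by rewrite divr_ge0 // c0_ge0.
  lra.
have sumT (F : 'I_K -> R) : \sum_(i in [set: 'I_K]) F i = \sum_i F i.
  by apply: eq_bigl => i; rewrite inE.
by move: h; rewrite !sumT.
Qed.

End Loop.

(** * The bad event *)

Section Counts.
Variables (R : realType) (K D T : nat) (B : R) (d : nat -> nat).

(** A round adds at most one play of [i] and starts only while the number of plays is below [T]. *)
Lemma cse_loop_count fuel S (arms : seq 'I_K) i : (count_mem i arms <= T)%N ->
  (count_mem i (cse_loop D T B fuel d (size arms).+1 S arms).2 <= T)%N.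
Proof.
elim: fuel S arms => [|fuel IH] S arms //= le_T.
case: ifP => // lt_T; rewrite addSn cardE -size_cat.
have le' : (count_mem i (arms ++ enum S) <= T)%N.
  rewrite count_round; apply: leq_trans (ltnW lt_T).
  by rewrite -addn1 leq_add ?count_size // leq_b1.
by case: ifP => // _; apply: IH.
Qed.

Lemma cse_arms_count i : (count_mem i (cse_arms K D T B d) <= T)%N.
Proof. exact: (@cse_loop_count T.+1 [set: 'I_K] [::]). Qed.

(** After the first round the clock shows [K + 1 > T]. *)
Lemma cse_arms_single_round i : (T <= K)%N -> (count_mem i (cse_arms K D T B d) <= 1)%N.
Proof.
rewrite /cse_arms; case: T => [|T'] // TK.
have round1 : (count_mem i (enum [set: 'I_K]) <= 1)%N.
  by rewrite (count_uniq_mem _ (enum_uniq _)) leq_b1.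
rewrite /=; case: ifP => // _; case: ifP => // _.
by rewrite cardsT card_ord addnC addn1 ltnNge (leq_trans TK).
Qed.

End Counts.

Section BadEvent.
Variables (R : realType) (K D T : nat) (B : R) (p : 'I_K -> 'I_D.+1 -> R).
Hypothesis D_gt0 : (0 < D)%N.
Hypothesis p_ge0 : forall i x, 0 <= p i x.
Hypothesis p_sum1 : forall i, \sum_(x < D.+1) p i x = 1.
Local Notation L := (logT R T).
Hypothesis L_ge0 : 0 <= L.
Local Notation path := {ffun 'I_(H K T).+1 -> 'I_D.+1}.
Local Notation A ds := (cse_arms K D T B (dfun ds)).
Implicit Types ds : path.

(* The exponent minimizing Hoeffding's bound for a deviation of [sqrt (2 L / n)]. *)
Definition rate (n : nat) : R := 4 * Num.sqrt (2 * L / n%:R).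

Definition misestimated (i : 'I_K) (n : nat) ds : bool :=
  deviates p (rate n) n i (4 * L) (dfun ds) (A ds) ||
  deviates p (- rate n) n i (4 * L) (dfun ds) (A ds).

(** These ranges suffice: an arm is played at most [T] times and the clock never exceeds
    [T + K + 1]. *)
Definition bad ds : bool :=
  [exists i : 'I_K, [exists n : 'I_T.+1, (0 < n)%N && misestimated i n ds] ||
    [exists t : 'I_(T + K).+2, overdelayed p t i (16 * L) (dfun ds) (A ds)]].

Lemma not_bad_good ds : ~~ bad ds ->
  forall arms, prefix arms (A ds) -> good T p (dfun ds) arms.
Proof.
rewrite negb_exists => /forallP nbad arms pre; split.
- move=> i n /andP[n0 n_le].
  have := nbad i; rewrite negb_or => /andP[/existsPn est _].
  have n_leA : (n <= size (pulls (A ds) i))%N.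
    have /prefixP[l ->] := pre; have [l' -> _] := pulls_cat_prefix arms l i.
    by rewrite size_cat (leq_trans n_le) // leq_addr.
  have nT : (n < T.+1)%N.
    by rewrite ltnS (leq_trans n_leA) // size_pulls cse_arms_count.
  have := est (Ordinal nT); rewrite /= n0 /= /misestimated /deviates n_leA /=.
  rewrite (take_pulls_prefix pre n_le).
  set y := Num.sqrt _; have rE : rate n = 4 * y by [].
  have N0 : 0 < n%:R :> R by rewrite ltr0n.
  have y0 : 0 <= y by exact: sqrtr_ge0.
  have y2 : y ^+ 2 = 2 * L / n%:R by rewrite sqr_sqrtr // divr_ge0 ?mulr_ge0.
  have e : y ^+ 2 * n%:R = 2 * L by rewrite y2 divfK // gt_eqF.
  have sz : size (take n (pulls arms i)) = n by rewrite size_takel.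
  have sumE (l : R) : \sum_(s <- take n (pulls arms i))
        (l * (cost R D (dfun ds) s - mu p i) - l ^+ 2 / 8) =
      l * \sum_(s <- take n (pulls arms i)) (cost R D (dfun ds) s - mu p i) -
      n%:R * (l ^+ 2 / 8).
    by rewrite sumrB -mulr_sumr [X in _ - X]big_const_seq count_predT sz iter_addr_0 mulr_natl.
  rewrite !sumE rE negb_or -!ltNge => /andP[]; set X := \sum_(s <- _) _ => up lo.
  (* A zero width forces [L = 0], and the strict inequality [up] then reads [0 < 0]. *)
  have [yz|yn0] := eqVneq y 0.
    have Lz : L = 0 by move: e; rewrite yz expr0n mul0r; lra.
    by move: up; rewrite yz Lz !mulr0 expr0n !mul0r mulr0 subrr ltxx.
  have yp : 0 < y by rewrite lt_def yn0.
  (* As [n y^2 = 2 L], the threshold plus the variance term, [4 L + n (4 y)^2 / 8], equals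
     [4 n y^2]. *)
  have b1 : 4 * y * X < 4 * y * (n%:R * y) by lra.
  have b2 : 4 * y * - X < 4 * y * (n%:R * y) by lra.
  have y4 : 0 < 4 * y by rewrite mulr_gt0.
  rewrite ler_norml; apply/andP; split.
    by rewrite lerNl ltW // -(ltr_pM2l y4).
  by rewrite ltW // -(ltr_pM2l y4).
- move=> i; have := nbad i; rewrite negb_or => /andP[_ /existsPn del].
  have szA : (size (A ds) <= T + K)%N by exact: cse_loop_size.
  have t_lt : ((size arms).+1 < (T + K).+2)%N.
    rewrite !ltnS; apply: leq_trans szA; have /prefixP[l ->] := pre.
    by rewrite size_cat leq_addr.
  have := del (Ordinal t_lt); rewrite /overdelayed -leNgt /=.
  rewrite -big_filter filter_pulls_prefix //.
  have -> : delayed (dfun ds) (A ds) i (size arms).+1 = delayed (dfun ds) arms i (size arms).+1.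
    have E a : delayed (dfun ds) a i (size arms).+1 =
        size [seq s <- [seq s <- pulls a i | s < (size arms).+1]
             | (size arms).+1 <= s + dfun ds s]%N.
      rewrite /delayed -filter_predI; congr size; apply: eq_filter => s /=.
      exact: andbC.
    by rewrite !E filter_pulls_prefix // filter_pulls_prefix // prefix_refl.
  by [].
Qed.

(** Union bound over [K (2 (T + 1) + T + K + 2)] events of probability at most [T^-4] each; for
    [K < T] there are at most [4 T^2] of them. *)
Lemma prob_bad : (K < T)%N ->
  \sum_(ds : path) path_weight B p ds * (bad ds)%:R <= 4 / T%:R ^+ 2.
Proof.
move=> KT; have T0 := leq_ltn_trans (leq0n K) KT.
have TR : 0 < T%:R :> R by rewrite ltr0n.
have e4 : expR (- (4 * L)) = T%:R ^- 4 by rewrite expRN expRM_natl lnK // posrE.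
have union ds : (bad ds)%:R <=
    \sum_(i < K) (\sum_(n < T.+1) ((deviates p (rate n) n i (4 * L) (dfun ds) (A ds))%:R +
      (deviates p (- rate n) n i (4 * L) (dfun ds) (A ds))%:R) +
    \sum_(t < (T + K).+2) (overdelayed p t i (16 * L) (dfun ds) (A ds))%:R) :> R.
  have pos i : 0 <= \sum_(n < T.+1) ((deviates p (rate n) n i (4 * L) (dfun ds) (A ds))%:R +
      (deviates p (- rate n) n i (4 * L) (dfun ds) (A ds))%:R) :> R.
    by apply: sumr_ge0 => n _; rewrite addr_ge0.
  have pos' i : 0 <= \sum_(t < (T + K).+2) (overdelayed p t i (16 * L) (dfun ds) (A ds))%:R :> R.
    by apply: sumr_ge0.
  case: (boolP (bad ds)) => [/existsP[i]|_]; last first.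
    by apply: sumr_ge0 => i _; rewrite addr_ge0.
  move=> h; rewrite (bigD1 i) //=; apply: ler_wpDr.
    by apply: sumr_ge0 => j _; rewrite addr_ge0.
  case/orP: h => [/existsP[n /andP[_ dev]]|/existsP[t od]].
    apply: ler_wpDr => //; rewrite (bigD1 n) //=; apply: ler_wpDr.
      by apply: sumr_ge0 => k _; rewrite addr_ge0.
    by case/orP: dev => ->; rewrite ?lerDl ?lerDr.
  apply: ler_wpDl => //; rewrite (bigD1 t) //= od; apply: ler_wpDr => //.
  by apply: sumr_ge0.
pose P ds := path_weight B p ds.
apply: (@le_trans _ _ (\sum_(i < K) (\sum_(n < T.+1) (T%:R ^- 4 + T%:R ^- 4) +
    \sum_(t < (T + K).+2) T%:R ^- 4))).
  apply: (@le_trans _ _ (\sum_(ds : path) P ds *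
    \sum_(i < K) (\sum_(n < T.+1) ((deviates p (rate n) n i (4 * L) (dfun ds) (A ds))%:R +
      (deviates p (- rate n) n i (4 * L) (dfun ds) (A ds))%:R) +
    \sum_(t < (T + K).+2) (overdelayed p t i (16 * L) (dfun ds) (A ds))%:R))).
    by apply: ler_sum => ds _; rewrite ler_wpM2l // path_weight_ge0.
  under eq_bigr => ds _ do rewrite mulr_sumr.
  rewrite exchange_big /=; apply: ler_sum => i _.
  under eq_bigr => ds _ do rewrite mulrDr !mulr_sumr.
  rewrite big_split /= lerD //.
    rewrite exchange_big /=; apply: ler_sum => n _.
    under eq_bigr => ds _ do rewrite mulrDr.
    by rewrite big_split /= -e4 lerD //; exact: prob_deviates.
  rewrite exchange_big /=; apply: ler_sum => t _.
  apply: le_trans (@prob_overdelayed R K D T B p p_ge0 p_sum1 t i (16 * L)) _.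
  by rewrite -e4 ler_expR lerN2 ler_wpM2r // ler_nat.
rewrite !sumr_const !card_ord.
have cnt : ((T.+1 + T.+1 + (T + K).+2) * K <= 4 * T ^ 2)%N.
  by move: KT; rewrite expnS expn1; nia.
have -> : 4 / T%:R ^+ 2 = T%:R ^- 4 * (4 * T ^ 2)%N%:R :> R.
  by rewrite natrM natrX; field; rewrite gt_eqF.
have q0 : 0 <= T%:R ^- 4 :> R by rewrite invr_ge0 exprn_ge0.
rewrite -(ler_nat R) in cnt; apply: le_trans (ler_wpM2l q0 cnt).
by rewrite mulr_natr mulrnA !mulrnDr -mulrnDl.
Qed.
End BadEvent.

(** * Combining the good and the bad event *)

Theorem theorem1 (R : realType) (K D T : nat) (p : 'I_K -> 'I_D.+1 -> R)
    (istar : 'I_K) (B : R) :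
  (0 < D)%N ->
  (forall i x, 0 <= p i x) ->
  (forall i, \sum_(x < D.+1) p i x = 1) ->
  (forall i, i != istar -> mu p istar < mu p i) ->
  0 < B ->
  cse_regret T B p istar <=
    \sum_(i < K | 0 < gap p istar i) (129 * ln (T%:R : R)) / gap p istar i
    + 8 * D%:R * Num.min B (D%:R * gapmax p istar) * ln (K%:R : R).
Proof.
move=> D_gt0 p_ge0 p_sum1 istar_min B_gt0.
have opt i : mu p istar <= mu p i.
  by have [->|/istar_min/ltW] := eqVneq i istar.
have g0 i : 0 <= gap p istar i by exact: gap_ge0.
have K_gt0 : (0 < K)%N by apply: leq_ltn_trans (ltn_ord istar).
have cap0 : 0 <= Num.min B (D%:R * gapmax p istar) by exact: cap_ge0.
have lnK0 : 0 <= ln (K%:R : R) by rewrite ln_ge0 // ler1n.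
have D0 : 0 <= D%:R :> R by [].
set cap := Num.min _ _ in cap0 *.
have capK : 0 <= D%:R * cap * ln (K%:R : R) by rewrite !mulr_ge0.
rewrite big_mkcond /=.
(* Division by zero yields [0], so arms of zero gap may be kept in the sum. *)
have sum_gap_pos (c : R) : \sum_i c * (ln T%:R / gap p istar i) =
    \sum_i (if 0 < gap p istar i then c * ln T%:R / gap p istar i else 0).
  apply: eq_bigr => i _; case: ltP => [_|gi]; first by rewrite mulrA.
  by rewrite (_ : gap p istar i = 0) ?invr0 ?mulr0 //; apply/le_anti; rewrite gi g0.
rewrite -sum_gap_pos.
have weight_sum (F : {ffun 'I_(H K T).+1 -> 'I_D.+1} -> R) (c : R) : 0 <= c ->
    (forall ds, F ds <= c) -> \sum_ds path_weight B p ds * F ds <= c.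
  move=> c0 Fc; apply: (@le_trans _ _ (\sum_ds path_weight B p ds * c)).
    by apply: ler_sum => ds _; rewrite ler_wpM2l // path_weight_ge0.
  by rewrite -mulr_suml ler_piMl // mass_le1.
(* For [T <= 1] nothing is played, and [ln T = 0], with [ln 0 = 0] by convention. *)
have [T_le1|T_gt1] := leqP T 1.
  have lnT : ln (T%:R : R) = 0.
    by case: T T_le1 {sum_gap_pos weight_sum} => [|[|]] // _; rewrite ?ln1 // ln0.
  apply: weight_sum => [|ds].
    by rewrite addr_ge0 //; [apply: sumr_ge0 => i _; rewrite lnT mul0r mulr0|lra].
  rewrite (_ : cse_arms _ _ _ _ _ = [::]); last first.
    by rewrite /cse_arms /= ltnNge T_le1.
  rewrite big_nil addr_ge0 //; last by lra.
  by apply: sumr_ge0 => i _; rewrite lnT mul0r mulr0.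
have L_ge : 2 / 3 <= logT R T.
  apply: le_trans (ln2_ge R) _; rewrite ler_ln ?posrE ?ltr0n // ?ler_nat //.
  exact: ltnW.
have X_ge0 i : 0 <= ln (T%:R : R) / gap p istar i.
  by rewrite divr_ge0 //; move: L_ge; rewrite /logT; lra.
have gapX i : gap p istar i <= 3 / 2 * (ln T%:R / gap p istar i).
  have [gi|gi] := ltP 0 (gap p istar i).
    exact: (gap_le_logT D_gt0 p_ge0 p_sum1 L_ge gi).
  by have := X_ge0 i; lra.
have sumX0 : 0 <= \sum_i ln (T%:R : R) / gap p istar i by apply: sumr_ge0.
have sum_gapX : \sum_i gap p istar i <= 3 / 2 * \sum_i ln T%:R / gap p istar i.
  by rewrite mulr_sumr; apply: ler_sum.
rewrite -mulr_sumr.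
set X := \sum_i ln _ / _ in sumX0 sum_gapX *.
(* A single round costs at most the sum of the gaps, hence [3 / 2 * X]. *)
have [TK|KT] := leqP T K.
  apply: weight_sum => [|ds]; first by lra.
  have := sum_le_count g0 (fun i => cse_arms_single_round D B (dfun ds) i TK).
  by rewrite mul1r; lra.
have harmK : 16 / 5 * D%:R * cap * harmonic_sum R K <= 8 * D%:R * cap * ln (K%:R : R).
  (* With one arm the harmonic sum exceeds [ln K = 0], but [cap] vanishes. Otherwise
     [16 / 5 * 5 / 2 = 8]. *)
  have [K1|K1] := leqP K 1.
    have gap0 i : gap p istar i = 0.
      rewrite (_ : i = istar) /gap ?subrr //; apply/val_inj => /=.
      by move: (leq_trans (ltn_ord i) K1) (leq_trans (ltn_ord istar) K1);
        case: (val i) (val istar) => [|?] [|?].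
    have -> : cap = 0.
      rewrite /cap (_ : gapmax p istar = 0) ?mulr0 ?min_r // ?ltW //.
      by rewrite /gapmax; apply: big1_idem => [|i _]; [exact: maxxx | exact: gap0].
    by rewrite !(mulr0, mul0r).
  have := ler_wpM2l (mulr_ge0 D0 cap0) (harmonic_sum_ln R K1); lra.
have path_regret (ds : {ffun 'I_(H K T).+1 -> 'I_D.+1}) :
    \sum_(a <- cse_arms K D T B (dfun ds)) gap p istar a <=
    (110 * X + 8 * D%:R * cap * ln K%:R) + (bad B p ds)%:R * (T%:R * \sum_i gap p istar i).
  case: (boolP (bad B p ds)) => [_|nbad].
    rewrite mul1r; apply: ler_wpDl; first by lra.
    by apply: sum_le_count => // i; exact: cse_arms_count.
  rewrite mul0r addr0.
  have d_le s : (dfun ds s <= D)%N by rewrite /dfun -ltnS.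
  have L0 : 0 <= logT R T by move: L_ge; lra.
  have := cse_regret_good D_gt0 p_ge0 p_sum1 opt B_gt0 L_ge d_le (not_bad_good L0 nbad).
  by rewrite -mulr_sumr -/X -/cap; move: harmK; lra.
have TR : 2 <= T%:R :> R by rewrite ler_nat.
apply: (@le_trans _ _ (\sum_(ds : {ffun 'I_(H K T).+1 -> 'I_D.+1}) (path_weight B p ds *
    (110 * X + 8 * D%:R * cap * ln K%:R) +
    path_weight B p ds * (bad B p ds)%:R * (T%:R * \sum_i gap p istar i)))).
  apply: ler_sum => ds _.
  apply: le_trans (ler_wpM2l (path_weight_ge0 _ p_ge0 _) (path_regret ds)) _.
  by rewrite [leLHS]mulrDr lerD2l -[leRHS]mulrA.
rewrite big_split /= -!mulr_suml.
have sg0 : 0 <= T%:R * \sum_i gap p istar i by rewrite mulr_ge0 // sumr_ge0.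
have Y0 : 0 <= 110 * X + 8 * D%:R * cap * ln K%:R by lra.
have := ler_wpM2r Y0 (mass_le1 T B p_ge0 p_sum1); rewrite mul1r => h1.
have L0 : 0 <= logT R T by move: L_ge; lra.
have h2 := ler_wpM2r sg0 (prob_bad B D_gt0 p_ge0 p_sum1 L0 KT).
(* The bad event thus adds at most twice the sum of the gaps, that is [3 * X], and
   [110 + 3 <= 129]. *)
have h3 : 4 / T%:R ^+ 2 * (T%:R * \sum_i gap p istar i) <= 2 * \sum_i gap p istar i.
  have -> : 4 / T%:R ^+ 2 * (T%:R * \sum_i gap p istar i) = 4 / T%:R * \sum_i gap p istar i.
    by field; rewrite gt_eqF //; lra.
  rewrite ler_wpM2r ?sumr_ge0 // ler_pdivrMr //; lra.
by lra.
Qed.
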